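(* Assume $T\ge 3$ and that there are constants $\gamma_t\ge 0$ ($t=0,\dots,T-1$) with $|C_t(x)-C_t(y)|\le\gamma_t|x-y|$ for all $x,y$. Then for every $x$ with $z_{k-1}<x\le z_k$, $z_k\in Z_\theta$, $$|v^\pi_0(x)-v_0(x)|\le\bar\omega_0(z_k)+\bar\epsilon_0(z_k)\le U^\omega_0(z_k)+U^\epsilon_0(z_k)\le\bar U^\omega_0(\theta)+\bar U^\epsilon_0(\theta).$$ In particular $\sup_x|v^\pi_0(x)-v_0(x)|\to 0$ as $\theta\to 0$.
   Context: Model. Fix an integer horizon $T$, a discount factor $\alpha\in(0,1]$, and for $t=0,\dots,T-1$: unit ordering costs $c_t\in\mathbb R$, a salvage coefficient $c_T\in\mathbb R$, setup costs $K_t\ge 0$, functions $G_t:\mathbb R\to\mathbb R$, and independent nonnegative random demands $D_0,\dots,D_{T-1}$ with right-continuous distribution functions $F_t$ and finite means; all expectations appearing are assumed finite. Let $\delta(z)=1$ for $z>0$, $\delta(0)=0$. Put $C_t(y)=(c_t-\alpha c_{t+1})y+G_t(y)+\alpha c_{t+1}E[D_t]$. Standing assumptions: (i) each $C_t$ is convex with $C_t(y)\to+\infty$ as $|y|\to\infty$; (ii) $K_t\ge \alpha K_{t+1}$ for $t=0,\dots,T-2$. Optimal costs: $v_T(x)=-c_Tx$, $v_t(x)=\min_{y\ge x}\{K_t\delta(y-x)+c_t(y-x)+G_t(y)+\alpha E[v_{t+1}(y-D_t)]\}$. Grid construction. Fix $\theta>0$, $z_m=m\theta$, $Z_\theta=\{z_m:m\in\mathbb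 Z\}$, $f_t(n)=F_t(z_{n+1})-F_t(z_n)$ ($n\ge -1$). $C^m_t=\min\{y: C_t(y)=\min_x C_t(x)\}$; with $z_{n_0}<C^m_t\le z_{n_0+1}$, $S^U_t=\min\{z_m\in Z_\theta: z_m\ge C^m_t,\ C_t(z_m)>C_t(z_{n_0})+K_t\}$. $s_{T-1}$ is a point with $s_{T-1}\le C^m_{T-1}$, $C_{T-1}(s_{T-1})=C_{T-1}(C^m_{T-1})+K_{T-1}$; $\bar I_{T-1}=s_{T-1}$. For $t=T-2,\dots,0$: $I_t=\max\{z_m\in Z_\theta: z_m<\min(\bar I_{t+1}-\theta,C^m_t)\}$, $\bar I_t=\max\{z_m\in Z_\theta: z_m\le I_t,\ C_t(z_m)>C_t(I_t)+K_t\}+\theta$. $H_{T-1}=C_{T-1}$, $S_{T-1}=C^m_{T-1}$; $V_t(y)=H_t(S_t)+K_t$ for $y<s_t$, $V_t(y)=H_t(y)$ for $y\ge s_t$. For $t=T-2,\dots,0$: $H_t(y)=C_t(y)+\alpha\sum_{n=-1}^\infty V_{t+1}(y-z_n)f_t(n)$; $S_t=\max\{z_m\in Z_\theta: I_t\le z_m\le S^U_t,\ H_t(z_m)=\min\{H_t(z_n):z_n\in Z_\theta, I_t\le z_n\le S^U_t\}\}$; $s_t=S_t$ if $K_t=0$, else $s_t=\min\{z_m\in Z_\theta:\bar I_t\le z_m\le S_t,\ H_t(z_m)\le H_t(S_t)+K_t\}$. Policy cost. $v^\pi_T(x)=-c_Tx$ and, for $t\le T-1$, with $y_t(x)=S_t$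 if $x<s_t$ and $y_t(x)=x$ otherwise, $v^\pi_t(x)=K_t\delta(y_t(x)-x)+c_t(y_t(x)-x)+G_t(y_t(x))+\alpha E[v^\pi_{t+1}(y_t(x)-D_t)]$. Estimate functions. $\psi_{T-1}(x,y)=\bar\psi_{T-1}(x,y)=\gamma_{T-1}x$; $\varphi_{T-1}(x,y)=\bar\varphi_{T-1}(x,y)=0$ if $y<s_{T-1}$ and $=\gamma_{T-1}x$ if $y\ge s_{T-1}$. For $t=0,\dots,T-2$, with $n$ the integer such that $z_{n-1}\le y-s_{t+1}<z_n$: $\psi_t(x,y)=\gamma_tx$ if $y<s_{t+1}-\theta$, else $\psi_t(x,y)=\gamma_tx+\alpha\sum_{m=-1}^{n-1}\varphi_{t+1}(x,y-z_m)f_t(m)$; $\varphi_t(x,y)=0$ if $y<s_t$, $=\psi_t(y-s_t,y)$ if $y\ge s_t$ and $y-x<s_t$, $=\psi_t(x,y)$ if $y\ge s_t$ and $y-x\ge s_t$. Likewise $\bar\psi_t(x,y)=\gamma_tx$ if $y<s_{t+1}-\theta$, else $\bar\psi_t(x,y)=\gamma_tx+\alpha\sum_{m=-1}^{n-1}\bar\varphi_{t+1}(x,y-z_m)f_t(m)$; $\bar\varphi_t(x,y)=0$ if $y<s_t$, $=\bar\psi_t(y-s_t+\theta,y)$ if $y\ge s_t$ and $y-x<s_t$, $=\bar\psi_t(x,y)$ if $y\ge s_t$ and $y-x\ge s_t$. Error-bound functions. $\omega_{T-1}\equiv\bar\omega_{T-1}\equiv 0$, $\eta_{T-1}=0$.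 For $t=T-2,\dots,0$: $\omega_t(x)=\psi_t(\theta,x)-\gamma_t\theta+\alpha\sum_{n=-1}^\infty\bar\omega_{t+1}(x-z_n)f_t(n)$; $\eta_t=\bar\psi_t(\theta,S^U_t)+\omega_t(S^U_t)$; $\bar\omega_t(x)=\eta_t$ if $x\le S^U_t$ and $\bar\omega_t(x)=\max(\eta_t,\omega_t(x))$ if $x>S^U_t$. For $z_k\in Z_\theta$: $\bar\epsilon_{T-2}(z_k)=\alpha\gamma_{T-1}\theta$ and for $t=0,\dots,T-3$, $\bar\epsilon_t(z_k)=\alpha^{T-1-t}\gamma_{T-1}\theta+\sum_{i=0}^{T-3-t}2\alpha^i[\bar\psi_{t+i}(\theta,\max(\lambda_t(i),S_{t+i}))-\gamma_{t+i}\theta]$, with $\lambda_t(0)=z_k$, $\lambda_t(i)=\max(\lambda_t(i-1),S_{t+i-1})+\theta$. Simple bounds (at $t=0$). With $\mu_0(0)=z_k$, $\mu_0(i)=\max(\mu_0(i-1),S^U_{i-1})+\theta$: $U^\omega_0(z_k)=\theta\sum_{i=0}^{T-2}\alpha^i\gamma_i+\theta\sum_{i=0}^{T-2}\sum_{n=1}^{T-1-i}\alpha^{n+i}\gamma_{i+n}\big[\prod_{m=0}^{n-1}F_{i+m}(S^U_i+(m+1)\theta-s_{i+m+1})+\prod_{m=0}^{n-1}F_{i+m}(\max(\mu_0(i),S^U_i)+(m+1)\theta-s_{i+m+1})\big]$; $\bar U^\omega_0(\theta)=\theta\sum_{i=0}^{T-2}\alpha^i\gamma_i+2\theta\sum_{i=0}^{T-2}\sum_{n=1}^{T-1-i}\alpha^{n+i}\gamma_{i+n}$;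 $U^\epsilon_0(z_k)=\alpha^{T-1}\gamma_{T-1}\theta+2\theta\sum_{i=0}^{T-3}\sum_{n=1}^{T-1-i}\alpha^{n+i}\gamma_{i+n}\prod_{m=0}^{n-1}F_{i+m}(\max(\lambda_0(i),S_i)+(m+1)\theta-s_{i+m+1})$; $\bar U^\epsilon_0(\theta)=\alpha^{T-1}\gamma_{T-1}\theta+2\theta\sum_{i=0}^{T-3}\sum_{n=1}^{T-1-i}\alpha^{n+i}\gamma_{i+n}$. *)

(* Defs.v *)
From HB Require Import structures.
From mathcomp Require Import all_boot all_order all_algebra.
From mathcomp Require Import all_classical all_reals all_analysis.
Import Order.TTheory GRing.Theory Num.Theory.
Import numFieldNormedType.Exports.

Set Implicit Arguments.
Unset Strict Implicit.
Unset Printing Implicit Defensive.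

Local Open Scope ring_scope.
Local Open Scope classical_set_scope.

(* Data of the inventory model: horizon T, discount alpha, unit costs
   c_0..c_T (c_T the salvage coefficient), setup costs K_t, functions G_t,
   and the distributions of the demands D_t (probability measures on R). *)
Record invModel (R : realType) := InvModel {
  horizon : nat;
  disc : R;
  cost : nat -> R;
  setup : nat -> R;
  Gf : nat -> R -> R;
  demand : nat -> probability R R }.

Section Model.
Variable R : realType.
Variable M : invModel R.
Local Notation T := (horizon M).
Local Notation alpha := (disc M).
Local Notation c := (cost M).
Local Notation K := (setup M).
Local Notation G := (Gf M).
Local Notation P := (demand M).

Definition expect (t : nat) (g : R -> R) : R := fine (\int[P t]_d (g d)%:E)%E.
Definition mean_demand (t : nat) : R := expect t id.
Definition cdf (t : nat) (x : R) : R := fine (P t `]-oo, x]).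
Definition Cfun (t : nat) (y : R) : R :=
  (c t - alpha * c t.+1) * y + G t y + alpha * c t.+1 * mean_demand t.
Definition delta (z : R) : R := if 0 < z then 1 else 0.

Fixpoint vrev (k : nat) : R -> R :=
  match k with
  | 0 => fun x => - c T * x
  | k'.+1 => fun x =>
      let t := (T - k'.+1)%N in
      inf [set K t * delta (y - x) + c t * (y - x) + G t y
               + alpha * expect t (fun d => vrev k' (y - d)) | y in [set y | x <= y]]
  end.
Definition vopt (t : nat) : R -> R := vrev (T - t).

Definition Cmin (t : nat) : R := inf [set y | forall x, Cfun t y <= Cfun t x].

Variable theta : R.
Variable sT1 : R.

Definition zg (m : int) : R := m%:~R * theta.
Definition onGrid (z : R) : Prop := exists m : int, z = zg m.
Definition fmass (t : nat) (n : int) : R := cdf t (zg (n + 1)) - cdf t (zg n).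
Definition gsum (a : int -> R) : R := limn (fun N => \sum_(k < N) a (k%:Z - 1)).
Definition gmaxlt (a : R) : R := sup [set z | onGrid z /\ z < a].
Definition SU (t : nat) : R :=
  inf [set z | onGrid z /\ Cmin t <= z /\ Cfun t (gmaxlt (Cmin t)) + K t < Cfun t z].

Record stage := Stage { stH : R -> R; stS : R; sts : R; stIbar : R }.

Definition Vof (t : nat) (st : stage) (y : R) : R :=
  if y < sts st then stH st (stS st) + K t else stH st y.

Fixpoint grev (k : nat) : stage :=
  match k with
  | 0 => Stage (Cfun T.-1) (Cmin T.-1) sT1 sT1
  | k'.+1 =>
      let t := (T.-1 - k'.+1)%N in
      let pr := grev k' in
      let I := gmaxlt (Num.min (stIbar pr - theta) (Cmin t)) in
      let Ib := sup [set z | onGrid z /\ z <= I /\ Cfun t I + K t < Cfun t z] + theta in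
      let H := fun y => Cfun t y
                 + alpha * gsum (fun n => Vof t.+1 pr (y - zg n) * fmass t n) in
      let S := sup [set z | onGrid z /\ I <= z <= SU t /\
                   (forall w, onGrid w -> I <= w <= SU t -> H z <= H w)] in
      let s := if K t == 0 then S
               else inf [set z | onGrid z /\ Ib <= z <= S /\ H z <= H S + K t] in
      Stage H S s Ib
  end.
Definition gst (t : nat) : stage := grev (T.-1 - t).
Definition Hf (t : nat) : R -> R := stH (gst t).
Definition Sg (t : nat) : R := stS (gst t).
Definition sg (t : nat) : R := sts (gst t).
Definition Ibar (t : nat) : R := stIbar (gst t).
Definition Vfun (t : nat) : R -> R := Vof t (gst t).

Definition ypol (t : nat) (x : R) : R := if x < sg t then Sg t else x.
Fixpoint vpirev (k : nat) : R -> R :=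
  match k with
  | 0 => fun x => - c T * x
  | k'.+1 => fun x =>
      let t := (T - k'.+1)%N in
      let y := ypol t x in
      K t * delta (y - x) + c t * (y - x) + G t y
        + alpha * expect t (fun d => vpirev k' (y - d))
  end.
Definition vpi (t : nat) : R -> R := vpirev (T - t).

Variable gamma : nat -> R.

(* the integer n with z_{n-1} <= y - s < z_n *)
Definition nidx (y s : R) : nat := absz (Num.floor ((y - s) / theta) + 1).

(* psirev b k = (psi_t, phi_t) (b = false) or (bar psi_t, bar phi_t) (b = true),
   for t = T-1-k *)
Fixpoint psirev (b : bool) (k : nat) : (R -> R -> R) * (R -> R -> R) :=
  match k with
  | 0 => let t := T.-1 in
         (fun x y => gamma t * x, fun x y => if y < sg t then 0 else gamma t * x)
  | k'.+1 =>
      let t := (T.-1 - k'.+1)%N in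
      let phi' := (psirev b k').2 in
      let psi := fun x y =>
        if y < sg t.+1 - theta then gamma t * x
        else gamma t * x + alpha * \sum_(j < (nidx y (sg t.+1)).+1)
               phi' x (y - zg (j%:Z - 1)) * fmass t (j%:Z - 1) in
      let phi := fun x y =>
        if y < sg t then 0
        else if y - x < sg t then psi (y - sg t + (if b then theta else 0)) y
        else psi x y in
      (psi, phi)
  end.
Definition psi (t : nat) := (psirev false (T.-1 - t)).1.
Definition phi (t : nat) := (psirev false (T.-1 - t)).2.
Definition psib (t : nat) := (psirev true (T.-1 - t)).1.
Definition phib (t : nat) := (psirev true (T.-1 - t)).2.

Fixpoint omrev (k : nat) : R -> R :=
  match k with
  | 0 => fun _ => 0
  | k'.+1 =>
      let t := (T.-1 - k'.+1)%N in
      let om := fun x => psi t theta x - gamma t * theta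
                 + alpha * gsum (fun n => omrev k' (x - zg n) * fmass t n) in
      let eta := psib t theta (SU t) + om (SU t) in
      fun x => if x <= SU t then eta else Num.max eta (om x)
  end.
Definition omegabar (t : nat) : R -> R := omrev (T.-1 - t).
Definition omega (t : nat) (x : R) : R :=
  if t == T.-1 then 0 else
  psi t theta x - gamma t * theta
    + alpha * gsum (fun n => omegabar t.+1 (x - zg n) * fmass t n).

Fixpoint lam (t : nat) (zk : R) (i : nat) : R :=
  match i with
  | 0 => zk
  | i'.+1 => Num.max (lam t zk i') (Sg (t + i')) + theta
  end.
(* bar epsilon_t(z_k), t <= T-2 (for t = T-2 the sum is empty) *)
Definition epsbar (t : nat) (zk : R) : R :=
  alpha ^+ (T.-1 - t) * gamma T.-1 * theta
  + \sum_(0 <= i < (T - 2 - t)%N)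
      2 * alpha ^+ i * (psib (t + i) theta (Num.max (lam t zk i) (Sg (t + i)))
                        - gamma (t + i) * theta).

Fixpoint mu0 (zk : R) (i : nat) : R :=
  match i with
  | 0 => zk
  | i'.+1 => Num.max (mu0 zk i') (SU i') + theta
  end.

Definition Uomega0 (zk : R) : R :=
  theta * \sum_(0 <= i < T.-1) alpha ^+ i * gamma i
  + theta * \sum_(0 <= i < T.-1) \sum_(1 <= n < T - i)
      alpha ^+ (n + i) * gamma (i + n) *
      (\prod_(0 <= m < n) cdf (i + m) (SU i + m.+1%:R * theta - sg (i + m).+1)
       + \prod_(0 <= m < n)
           cdf (i + m) (Num.max (mu0 zk i) (SU i) + m.+1%:R * theta - sg (i + m).+1)).

Definition Uomegabar0 : R :=
  theta * \sum_(0 <= i < T.-1) alpha ^+ i * gamma i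
  + 2 * theta * \sum_(0 <= i < T.-1) \sum_(1 <= n < T - i)
      alpha ^+ (n + i) * gamma (i + n).

Definition Ueps0 (zk : R) : R :=
  alpha ^+ T.-1 * gamma T.-1 * theta
  + 2 * theta * \sum_(0 <= i < T - 2) \sum_(1 <= n < T - i)
      alpha ^+ (n + i) * gamma (i + n) *
      \prod_(0 <= m < n)
         cdf (i + m) (Num.max (lam 0 zk i) (Sg i) + m.+1%:R * theta - sg (i + m).+1).

Definition Uepsbar0 : R :=
  alpha ^+ T.-1 * gamma T.-1 * theta
  + 2 * theta * \sum_(0 <= i < T - 2) \sum_(1 <= n < T - i)
      alpha ^+ (n + i) * gamma (i + n).

End Model.

(* Main.v *)
(* Let V be the value function of the grid model, Vs the optimal value function and Vp the
   value function of the policy, each with c_t x added, so that all three satisfy recursions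
   with one-period cost C_t.
   On the grid, H_t is K_t-convex, hence (s_t, S_t) is optimal there. Off the grid, V_t is
   discontinuous only at the grid point s_t, where it drops by at most H_t(s_t - th) - H_t(s_t).
   Consequently the oscillation of H_t over a cell obeys the recursion of bar psi, while its
   upward increments and its oscillation inside a half-open cell obey that of psi.
   Backward induction then gives |V_t - Vs_t| <= omegabar_t and |Vp_t - V_t| <= epsbar_t.
   Iterating the recursion of bar psi, whose t-th term is nonzero only if the demands so far
   leave the inventory above s_t, bounds it by products of distribution functions, and
   replacing these by 1 leaves a multiple of th. *)

Require Import Defs.
From HB Require Import structures.
From mathcomp Require Import all_boot all_order all_algebra.
From mathcomp Require Import all_classical all_reals all_analysis.
From mathcomp Require Import zify ring lra.
Import Order.TTheory GRing.Theory Num.Theory.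
Import numFieldNormedType.Exports.

Set Implicit Arguments.
Unset Strict Implicit.
Unset Printing Implicit Defensive.

Local Open Scope ring_scope.
Local Open Scope classical_set_scope.

(** The grid model is the original one with each demand d replaced by a grid point [rd th d], where
    [rd th d] < d <= [rd th d] + th. So y - d lies at most one cell to the left of y - [rd th d],
    and comparisons of cost functions reduce to pointwise comparisons of integrands differing by
    such a shift. Rounded demands translate the grid into itself, which is why K-convexity survives
    there; but the true cost-to-go is evaluated at arbitrary reals. The obstacle is to show, off the
    grid, that ordering hardly pays right of s_t: this combines K-convexity at the left ends of the
    cells with monotone increments of convex functions, and costs one barred modulus. That loss is
    needed only up to S^U_t. Beyond it the one-period cost exceeds its value at z_{n_0}, next to the
    minimiser, by more than K_t, while the future cost can fall by at most alpha K_{t+1} <= K_t, so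
    such levels are dominated by z_{n_0} or by not ordering. Hence eta_t is evaluated at S^U_t, and
    omegabar_t exceeds it only through omega_t. *)

Lemma downward_ind (N : nat) (Q : nat -> Prop) :
  (0 < N)%N -> Q N.-1 -> (forall t, (t.+1 < N)%N -> Q t.+1 -> Q t) ->
  forall t, (t < N)%N -> Q t.
Proof.
move=> N0 base step t tN.
have [k ->] : exists k, t = (N.-1 - k)%N by exists (N.-1 - t)%N; lia.
elim: k => [|k IH]; first by rewrite subn0.
have [kN|Nk] := ltnP k N.-1.
  by apply: step; [lia | have -> : ((N.-1 - k.+1).+1 = N.-1 - k)%N by lia].
by have -> : (N.-1 - k.+1 = N.-1 - k)%N by lia.
Qed.

Lemma step_lt (N t : nat) : (t.+1 < N)%N -> (t < N)%N.
Proof. lia. Qed.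

Lemma ltn_last_or (N t : nat) : (t < N)%N -> t = N.-1 \/ (t.+1 < N)%N.
Proof. lia. Qed.

Lemma gst_rank (N t : nat) : (t.+1 < N)%N -> (N.-1 - t = (N.-1 - t.+1).+1)%N.
Proof. lia. Qed.

Lemma stage_index (N t : nat) : (t.+1 < N)%N -> (N.-1 - (N.-1 - t.+1).+1)%N = t.
Proof. lia. Qed.

(** * Arithmetic of the grid: rounding, extrema, minimisers *)

Section Grid.
Variables (R : realType) (th : R).
Hypothesis th0 : 0 < th.
Local Notation grid := (onGrid th).

Lemma zgD (m n : int) : zg th (m + n) = zg th m + zg th n.
Proof. by rewrite /zg intrD mulrDl. Qed.

Lemma zgB (m n : int) : zg th (m - n) = zg th m - zg th n.
Proof. by rewrite /zg intrB mulrBl. Qed.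

Lemma zg1 : zg th 1 = th.
Proof. by rewrite /zg mul1r. Qed.

Lemma zgS (m : int) : zg th m + th = zg th (m + 1).
Proof. by rewrite zgD zg1. Qed.

Lemma ler_zg (m n : int) : (zg th m <= zg th n) = (m <= n).
Proof. by rewrite /zg ler_pM2r// ler_int. Qed.

Lemma ltr_zg (m n : int) : (zg th m < zg th n) = (m < n).
Proof. by rewrite /zg ltr_pM2r// ltr_int. Qed.

Lemma grid_zg m : grid (zg th m).
Proof. by exists m. Qed.

Lemma gridD x y : grid x -> grid y -> grid (x + y).
Proof. by move=> [m ->] [n ->]; exists (m + n); rewrite zgD. Qed.

Lemma gridB x y : grid x -> grid y -> grid (x - y).
Proof. by move=> [m ->] [n ->]; exists (m - n); rewrite zgB. Qed.

Lemma grid_th : grid th.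
Proof. by exists 1; rewrite zg1. Qed.

Lemma gridDth x : grid x -> grid (x + th).
Proof. by move=> gx; apply: gridD => //; exact: grid_th. Qed.

Lemma gridBth x : grid x -> grid (x - th).
Proof. by move=> gx; apply: gridB => //; exact: grid_th. Qed.

Lemma gridMn n : grid (n%:R * th).
Proof. by exists n%:Z. Qed.

Lemma grid_lt_le x y : grid x -> grid y -> x < y -> x + th <= y.
Proof.
by move=> [m ->] [n ->]; rewrite zgS ltr_zg ler_zg => ?; lia.
Qed.

Lemma grid_le_of_lt x y : grid x -> grid y -> x < y + th -> x <= y.
Proof.
by move=> [m ->] [n ->]; rewrite zgS ltr_zg ler_zg => ?; lia.
Qed.

Lemma grid_stepsP x y : grid x -> grid y -> x <= y ->
  exists n : nat, y = x + n%:R * th.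
Proof.
move=> [m ->] [n ->]; rewrite ler_zg => mn; exists `|n - m|%N.
have -> : `|n - m|%:R * th = zg th (n - m).
  by rewrite /zg -[in RHS](gez0_abs (m := n - m)) ?subr_ge0//.
by rewrite zgB; ring.
Qed.

Definition gceil (x : R) : R := zg th (Num.ceil (x / th)).

Lemma gceil_grid x : grid (gceil x).
Proof. exact: grid_zg. Qed.

Lemma le_gceil x : x <= gceil x.
Proof. by rewrite /gceil /zg -ler_pdivrMr// ceil_ge. Qed.

Lemma gceil_lt x : gceil x < x + th.
Proof.
rewrite /gceil -ltrBlDr; have -> : zg th (Num.ceil (x / th)) - th =
  zg th (Num.ceil (x / th) - 1) by rewrite zgB zg1.
by rewrite /zg -ltr_pdivlMr// ceilB1_lt.
Qed.

Lemma gceil_le x z : grid z -> x <= z -> gceil x <= z.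
Proof.
move=> gz xz; apply: grid_le_of_lt => //; first exact: gceil_grid.
by rewrite (lt_le_trans (gceil_lt x))// lerD2r.
Qed.

Lemma gmaxlt_exists a : exists2 z, grid z & z < a <= z + th.
Proof.
exists (gceil a - th); first exact: gridBth (gceil_grid a).
by have := gceil_lt a; have := le_gceil a; lra.
Qed.

(** Distinct grid points are at least th apart, so a member of [A] within th of the supremum is
    already the supremum. This turns the [sup] in [gmaxlt], [Ibar] and [Sg] into maxima;
    [grid_inf_mem] does the same for the [inf] in [SU] and [sg]. *)
Lemma grid_sup_mem (A : set R) : A `<=` grid -> A !=set0 -> has_ubound A ->
  A (sup A) /\ (forall z, A z -> z <= sup A).
Proof.
move=> Ag A0 ubA; have hs : has_sup A by split.
have ub z : A z -> z <= sup A by move=> Az; exact: ub_le_sup.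
split=> //; have [z Az] := sup_adherent th0 hs; rewrite ltrBlDr => zs.
have -> // : sup A = z.
apply/le_anti; rewrite ub// andbT; apply: ge_sup => // w Aw.
by apply: grid_le_of_lt; [exact: Ag|exact: Ag|exact: le_lt_trans (ub _ Aw) zs].
Qed.

Lemma grid_inf_mem (A : set R) : A `<=` grid -> A !=set0 -> has_lbound A ->
  A (inf A) /\ (forall z, A z -> inf A <= z).
Proof.
move=> Ag A0 lbA; have hi : has_inf A by split.
have lb z : A z -> inf A <= z by move=> Az; exact: ge_inf.
split=> //; have [z Az zs] := inf_adherent th0 hi.
have -> // : inf A = z.
apply/le_anti; rewrite lb//=; apply: lb_le_inf => // w Aw.
apply: grid_le_of_lt; [exact: Ag|exact: Ag|].
by apply: lt_le_trans zs _; rewrite lerD2r lb.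
Qed.

Lemma gmaxltP a : [/\ grid (gmaxlt th a), gmaxlt th a < a & a <= gmaxlt th a + th].
Proof.
have [z gz /andP[za az]] := gmaxlt_exists a.
have [|||[gs sa] ub] := grid_sup_mem (A := [set z | grid z /\ z < a]).
- by move=> ? [].
- by exists z.
- by exists a => w [_ /ltW].
- split=> //; have /(_ (conj gz za)) := ub z.
  by rewrite -/(gmaxlt th a); lra.
Qed.

Lemma grid_argmin (h : R -> R) (a b : R) : grid a -> grid b -> a <= b ->
  exists z, [/\ grid z, a <= z <= b & forall w, grid w -> a <= w <= b -> h z <= h w].
Proof.
move=> ga gb ab; have [n ->] := grid_stepsP ga gb ab => {b gb ab}.
elim: n => [|n [z [gz zn hz]]].
  exists a; rewrite mul0r addr0 lexx; split=> // w gw aw.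
  by have -> // : w = a by apply/le_anti; rewrite andbC.
have e : a + n.+1%:R * th = a + n%:R * th + th by rewrite -natr1; ring.
have gn : grid (a + n.+1%:R * th) by apply: gridD => //; exact: gridMn.
have gn' : grid (a + n%:R * th) by apply: gridD => //; exact: gridMn.
have n0 : 0 <= n%:R * th by rewrite mulr_ge0// ltW.
have spl w : grid w -> a <= w <= a + n.+1%:R * th ->
    a <= w <= a + n%:R * th \/ w = a + n.+1%:R * th.
  move=> gw /andP[aw wn]; have [|] := leP w (a + n%:R * th).
    by left; rewrite aw.
  by move=> /(grid_lt_le gn' gw); right; apply/le_anti; rewrite wn e/=.
have [lt|ge] := ltP (h z) (h (a + n.+1%:R * th)).
  exists z; split=> //; first by case/andP: zn => -> zn; rewrite e (le_trans zn)// lerDl ltW.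
  by move=> w gw /(spl _ gw)[/(hz w gw)//|->]; rewrite ltW.
exists (a + n.+1%:R * th); split=> //; first by rewrite lexx andbT e -addrA lerDl addr_ge0// ltW.
by move=> w gw /(spl _ gw)[/(hz w gw) zw|-> //]; exact: le_trans ge zw.
Qed.

(* Demand in (z_n, z_(n+1)] is rounded down to z_n; in particular demand 0 becomes -th. *)
Definition rd (d : R) : R := zg th (Num.ceil (Num.max d 0 / th) - 1).

Lemma rd_grid d : grid (rd d).
Proof. exact: grid_zg. Qed.

Lemma rdP d : 0 <= d -> [/\ rd d < d, d <= rd d + th & - th <= rd d].
Proof.
move=> d0; rewrite /rd max_l//.
have -> : zg th (Num.ceil (d / th) - 1) = gceil d - th by rewrite zgB zg1.
have := gceil_lt d; have := le_gceil d => ? ?; split; lra.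
Qed.

End Grid.

(** * Expectations over the demand, and grid sums as expectations of the rounded demand *)

Section Expectation.
Variables (R : realType) (M : invModel R) (t : nat).
Local Notation P := (demand M t).

Definition integ (g : R -> R) : Prop := P.-integrable setT (fun d => (g d)%:E).

Lemma integ_cst c : integ (fun=> c).
Proof. exact: (@finite_measure_integrable_cst _ _ _ P setT c measurableT). Qed.

Lemma integD f g : integ f -> integ g -> integ (fun d => f d + g d).
Proof. by move=> fi gi; exact: (integrableD measurableT fi gi). Qed.

Lemma integZ k f : integ f -> integ (fun d => k * f d).
Proof. by move=> fi; exact: (integrableZl measurableT k fi). Qed.

Lemma integB f g : integ f -> integ g -> integ (fun d => f d - g d).
Proof. by move=> fi gi; exact: (integrableB measurableT fi gi). Qed.

Lemma expectD f g : integ f -> integ g ->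
  expect M t (fun d => f d + g d) = expect M t f + expect M t g.
Proof. by move=> fi gi; exact: (RintegralD measurableT fi gi). Qed.

Lemma expectB f g : integ f -> integ g ->
  expect M t (fun d => f d - g d) = expect M t f - expect M t g.
Proof. by move=> fi gi; exact: (RintegralB measurableT fi gi). Qed.

Lemma expectZ k f : integ f -> expect M t (fun d => k * f d) = k * expect M t f.
Proof. by move=> fi; exact: (RintegralZl k measurableT fi). Qed.

Lemma expect_cst c : expect M t (fun=> c) = c.
Proof.
transitivity (c * fine (P setT)); first exact: (Rintegral_cst P measurableT).
by rewrite probability_setT mulr1.
Qed.

Lemma expect_indic (A : set R) : measurable A ->
  expect M t (fun d => \1_A d) = fine (P A).
Proof.
by move=> mA; rewrite /expect integral_indic// setIT.
Qed.

Lemma integ_step (A : nat -> set R) (a : nat -> R) c N :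
  (forall k, measurable (A k)) ->
  integ (fun d => c + \sum_(k < N) a k * \1_(A k) d) /\
  expect M t (fun d => c + \sum_(k < N) a k * \1_(A k) d)
    = c + \sum_(k < N) a k * fine (P (A k)).
Proof.
move=> mA; elim: N => [|N [IHi IHe]].
  have -> : (fun d => c + \sum_(k < 0) a k * \1_(A k) d) = (fun=> c).
    by apply/funext => d; rewrite big_ord0 addr0.
  by rewrite big_ord0 addr0 expect_cst; split=> //; exact: integ_cst.
have -> : (fun d => c + \sum_(k < N.+1) a k * \1_(A k) d) =
    (fun d => (c + \sum_(k < N) a k * \1_(A k) d) + a N * \1_(A N) d).
  by apply/funext => d; rewrite big_ord_recr/= addrA.
have iA : integ (fun d => a N * \1_(A N) d).
  by apply: integZ; exact: integrable_indic.
split; first exact: integD.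
rewrite expectD// IHe expectZ ?expect_indic//; last exact: integrable_indic.
by rewrite big_ord_recr/= addrA.
Qed.

Hypothesis P0 : P `]-oo, 0[ = 0%E.

Lemma expectE_ge0 f : integ f -> expect M t f = fine (\int[P]_(d in `[0%R, +oo[) (f d)%:E)%E.
Proof.
move=> fi; rewrite /expect (negligible_integral _ measurableT fi P0)//.
congr (fine (integral _ _ _)); apply/seteqP; split=> x /=; rewrite !in_itv/= ?andbT.
  by move=> [_ /negP]; rewrite -leNgt.
by move=> x0; split=> //; apply/negP; rewrite -leNgt.
Qed.

(** Negative demands form a null set, so integrands need comparing only for d >= 0, where [rdP]
    brackets the rounded demand. *)
Lemma expect_le f g : integ f -> integ g -> (forall d, 0 <= d -> f d <= g d) ->
  expect M t f <= expect M t g.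
Proof.
move=> fi gi fg; rewrite !expectE_ge0//.
have sub h : integ h -> P.-integrable `[0, +oo[ (EFin \o h).
  by move=> hi; exact: (integrableS measurableT _ _ hi).
apply: (@le_Rintegral _ _ _ P `[0, +oo[ f g) => //; [exact: sub|exact: sub|].
by move=> x /=; rewrite in_itv/= andbT; exact: fg.
Qed.

Lemma expect_ge_cst f c : integ f -> (forall d, 0 <= d -> c <= f d) -> c <= expect M t f.
Proof.
by move=> fi cf; rewrite -(expect_cst c); apply: expect_le => //; exact: integ_cst.
Qed.

Lemma expect_le_cst f c : integ f -> (forall d, 0 <= d -> f d <= c) -> expect M t f <= c.
Proof.
by move=> fi cf; rewrite -[leRHS](expect_cst c); apply: expect_le => //; exact: integ_cst.
Qed.

Lemma cdf_ge0 x : 0 <= Defs.cdf M t x.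
Proof. by rewrite fine_ge0. Qed.

Lemma cdf_le1 x : Defs.cdf M t x <= 1.
Proof.
have -> : 1 = fine (1%:E : \bar R) by [].
by rewrite fine_le ?fin_num_measure// probability_le1.
Qed.

Lemma cdf_lt0 x : x < 0 -> Defs.cdf M t x = 0.
Proof.
move=> x0; apply/eqP; rewrite eq_le cdf_ge0 andbT.
have -> : 0 = fine (0%E : \bar R) by [].
rewrite fine_le ?fin_num_measure// -P0 le_measure ?inE//.
by apply: subset_itvl; rewrite bnd_simp.
Qed.

Lemma cdfB x y : x <= y -> fine (P `]x, y]) = Defs.cdf M t y - Defs.cdf M t x.
Proof.
move=> xy; rewrite /Defs.cdf.
have -> : P `]-oo, y] = (P `]-oo, x] + P `]x, y])%E.
  rewrite -measureU//.
    by rewrite -itv_bndbnd_setU// bnd_simp.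
  apply/seteqP; split=> z //=; rewrite !in_itv/= => -[zx /andP[xz _]].
  by move: (lt_le_trans xz zx); rewrite ltxx.
by rewrite fineD ?fin_num_measure//; ring.
Qed.

Lemma cdf_indic x : expect M t (fun d => \1_`]-oo, x] d) = Defs.cdf M t x.
Proof. by rewrite expect_indic. Qed.

Section Rounding.
Variable th : R.
Hypothesis th0 : 0 < th.

Lemma cdf_zg_cvg : (fun N : nat => Defs.cdf M t (zg th (N%:Z - 1))) @ \oo --> (1 : R).
Proof.
have : P \o (fun N : nat => `]-oo, zg th (N%:Z - 1)] : set R) @ \oo
    --> P (\bigcup_N `]-oo, zg th (N%:Z - 1)]).
  apply: nondecreasing_cvg_mu => //.
  - by apply: bigcup_measurable.
  - move=> m n mn; rewrite subsetEset; apply: subset_itvl.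
    by rewrite bnd_simp ler_zg//; lia.
have -> : \bigcup_N `]-oo, zg th (N%:Z - 1)] = [set: R].
  apply/seteqP; split=> // x _; exists (`|Num.ceil (x / th)| + 1)%N => //=.
  rewrite in_itv/=; apply: le_trans (le_gceil th0 x) _.
  by rewrite ler_zg// PoszD addrK lez_abs.
by rewrite probability_setT => /fine_cvg.
Qed.

(** The [Num.max d 0] sends the null set of negative demands to cell 0, so that the cells partition
    the whole line. Cell k carries the mass f_t(k - 1); cell 0 carries the atom at demand 0. *)
Definition demand_cell (k : nat) : set R := [set d | Num.ceil (Num.max d 0 / th) = k%:Z].

Lemma demand_cell0E : demand_cell 0 = `]-oo, 0].
Proof.
apply/seteqP; split=> d /=; rewrite in_itv/=.
  move=> /eqP; rewrite ceil_eq => /andP[_]; rewrite mulr0z pmulr_lle0 ?invr_gt0//.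
  by rewrite ge_max lexx andbT.
by move=> d0; rewrite /demand_cell/= max_r// mul0r ceil0.
Qed.

Lemma demand_cellSE k : demand_cell k.+1 = `]zg th k%:Z, zg th (k.+1)%:Z].
Proof.
have e : (k.+1%:Z - 1 = k%:Z)%R by lia.
have z0 : 0 <= zg th k%:Z by rewrite mulr_ge0// ltW.
apply/seteqP; split=> d /=; rewrite in_itv/=.
  move=> /eqP; rewrite ceil_eq e ltr_pdivlMr// ler_pdivrMr//.
  by rewrite lt_max ge_max (ltNge _ 0) z0/= orbF => /andP[-> /andP[->]].
move=> dk; rewrite /demand_cell/=; apply/eqP; rewrite ceil_eq e ltr_pdivlMr// ler_pdivrMr// max_l//.
by case/andP: dk => /ltW dk _; exact: le_trans z0 dk.
Qed.

Lemma measurable_demand_cell k : measurable (demand_cell k).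
Proof. by case: k => [|k]; [rewrite demand_cell0E|rewrite demand_cellSE]. Qed.

Lemma demand_cell_fmass k : fine (P (demand_cell k)) = fmass M th t (k%:Z - 1).
Proof.
case: k => [|k].
  by rewrite demand_cell0E /fmass subrK /zg mul0r [X in _ - X]cdf_lt0 ?subr0// mulN1r oppr_lt0.
have e : (k.+1%:Z - 1 = k%:Z)%R by lia.
by rewrite demand_cellSE cdfB ?ler_zg ?lez_nat// /fmass e -PoszD addn1.
Qed.

Lemma demand_cell_uniq d : exists k0, forall k, \1_(demand_cell k) d = (k == k0)%:R :> R.
Proof.
exists `|Num.ceil (Num.max d 0%R / th)|%N => k; rewrite indicE; congr ((nat_of_bool _)%:R).
have c0 : 0 <= Num.ceil (Num.max d 0 / th).
  rewrite ceil_ge0 (lt_le_trans (ltrN10 _))// mulr_ge0 ?invr_ge0// ?(ltW th0)//.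
  by rewrite le_max lexx orbT.
apply/idP/idP; rewrite in_setE /demand_cell /=; first by move=> ->.
by move=> /eqP ->; rewrite gez0_abs.
Qed.

Lemma rd_demand_cell k d : demand_cell k d -> rd th d = zg th (k%:Z - 1).
Proof. by rewrite /demand_cell /rd /= => ->. Qed.

(** Subtracting the value c taken on all far cells leaves a finite combination of cell indicators,
    so neither measurability nor growth of [g] matters. *)
Lemma integ_rd_fin (g : R -> R) y c N :
  (forall k : nat, (N <= k)%N -> g (y - zg th (k%:Z - 1)) = c) ->
  integ (fun d => g (y - rd th d)) /\
  expect M t (fun d => g (y - rd th d)) =
    c + \sum_(k < N) (g (y - zg th (k%:Z - 1)) - c) * fmass M th t (k%:Z - 1).
Proof.
move=> gc.
have -> : (fun d => g (y - rd th d)) =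
  (fun d => c + \sum_(k < N) (g (y - zg th (k%:Z - 1)) - c) * \1_(demand_cell k) d).
  apply/funext => d; have [k0 k0P] := demand_cell_uniq d.
  have dk0 : demand_cell k0 d.
    by have := k0P k0; rewrite eqxx indicE; case: (boolP (d \in _)) => [/set_mem|_ /eqP];
      rewrite // eq_sym oner_eq0.
  rewrite (rd_demand_cell dk0); under eq_bigr do rewrite k0P.
  have [Nk|kN] := leqP N k0.
    rewrite gc// big1 ?addr0// => k _.
    by rewrite (ltn_eqF (leq_trans (ltn_ord k) Nk)) mulr0.
  rewrite (bigD1 (Ordinal kN))//= eqxx mulr1 big1 => [|k /eqP kk].
    by rewrite addr0; ring.
  case: eqP => [e|]; rewrite ?mulr0//.
  by case: kk; exact: val_inj.
have [iA ->] := integ_step (fun k => g (y - zg th (k%:Z - 1)) - c) c N measurable_demand_cell.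
split=> //; congr (_ + _); apply: eq_bigr => k _; congr (_ * _).
exact: demand_cell_fmass.
Qed.

(** V_t, phi_t and omegabar_t are all constant far to the left. Large demands lead there, so along
    the rounded demand these functions take finitely many values; integrability and convergence of
    the grid sums follow. *)
Definition evcst (g : R -> R) : Prop := exists b c, forall z, z < b -> g z = c.

Lemma evcst_rank (y b : R) : exists N : nat,
  forall k : nat, (N <= k)%N -> y - zg th (k%:Z - 1) < b.
Proof.
exists (`|Num.ceil ((y - b) / th)| + 2)%N => k Nk; rewrite ltrBlDr -ltrBlDl.
apply: le_lt_trans (le_gceil th0 (y - b)) _.
by rewrite ltr_zg//; have := lez_abs (Num.ceil ((y - b) / th)); lia.
Qed.

Lemma integ_rd g y : evcst g -> integ (fun d => g (y - rd th d)).
Proof.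
move=> [b [c gc]]; have [N NP] := evcst_rank y b.
by have [|] := integ_rd_fin (g := g) (y := y) (c := c) (N := N) => // k Nk; apply: gc; exact: NP.
Qed.

Lemma sum_fmass N :
  \sum_(k < N) fmass M th t (k%:Z - 1) = Defs.cdf M t (zg th (N%:Z - 1)).
Proof.
elim: N => [|N IH].
  by rewrite big_ord0 cdf_lt0// /zg sub0r mulN1r oppr_lt0.
rewrite big_ord_recr/= IH /fmass addrC subrK; congr (Defs.cdf _ _ (zg _ _)); lia.
Qed.

Lemma gsum_expect g y : evcst g ->
  gsum (fun n => g (y - zg th n) * fmass M th t n) = expect M t (fun d => g (y - rd th d)).
Proof.
move=> [b [c gc]]; have [N NP] := evcst_rank y b.
have gcN k : (N <= k)%N -> g (y - zg th (k%:Z - 1)) = c.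
  by move=> Nk; apply: gc; exact: NP.
have [_ ->] := integ_rd_fin gcN.
apply: cvg_lim => //.
set a := \sum_(k < N) _.
have : (fun n : nat => a + c * Defs.cdf M t (zg th (n%:Z - 1))) @ \oo --> a + c * 1.
  by apply: cvgD; [exact: cvg_cst|apply: cvgMr; exact: cdf_zg_cvg].
rewrite mulr1 addrC; apply: cvg_trans; apply: near_eq_cvg.
near=> n; have Nn : (N <= n)%N by near: n; exact: nbhs_infty_ge.
(* Split g as (g - c) + c: the sum of the first part is stationary from N on, the second telescopes
   to c times the distribution function, which tends to c. *)
rewrite -sum_fmass mulr_sumr.
transitivity (\sum_(k < n) (g (y - zg th (k%:Z - 1)) - c) * fmass M th t (k%:Z - 1)
   + \sum_(k < n) c * fmass M th t (k%:Z - 1)); last first.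
  by rewrite -big_split/=; apply: eq_bigr => k _; ring.
congr (_ + _); rewrite /a.
pose F k := (g (y - zg th (k%:Z - 1)) - c) * fmass M th t (k%:Z - 1).
rewrite -(big_mkord xpredT F) -[RHS](big_mkord xpredT F).
rewrite [RHS](big_cat_nat (n := N))//= [X in _ = _ + X]big_nat_cond.
rewrite [X in _ = _ + X]big1 ?addr0// => k /andP[/andP[Nk _] _].
by rewrite /F gcN// subrr mul0r.
Unshelve. all: by end_near.
Qed.

End Rounding.
End Expectation.

(** * Convex coercive one-period costs *)

Section ConvexCost.
Variables (R : realType) (C : R -> R) (g : R).
Hypothesis convC : forall x y l : R, 0 <= l <= 1 -> C (l * x + (1 - l) * y) <= l * C x + (1 - l) * C y.
Hypothesis coerC : forall A : R, exists B : R, forall y : R, B <= `|y| -> A <= C y.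
Hypothesis g0 : 0 <= g.
Hypothesis lipC : forall x y : R, `|C x - C y| <= g * `|x - y|.
Local Notation m := (inf [set y : R | forall x, C y <= C x]).

(** Convexity at b, written as a combination of a and c. The shape matches [kconvex], so adding a
    nonnegative K yields K-convexity directly. *)
Lemma convex3 (a b c : R) : a < b -> b <= c -> (c - b) * (C b - C a) <= (b - a) * (C c - C b).
Proof.
move=> ab bc; have ac : 0 < c - a by lra.
have l01 : 0 <= (c - b) / (c - a) <= 1.
  by rewrite divr_ge0 ?subr_ge0// ?(ltW (lt_le_trans ab bc))//= ler_pdivrMr// mul1r; lra.
have := convC a c l01; set l := (c - b) / (c - a).
have el : l * (c - a) = c - b by rewrite /l -mulrA mulVf ?mulr1// gt_eqF.
have -> : l * a + (1 - l) * c = b.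
  by transitivity (c - l * (c - a)); [ring|rewrite el; ring].
rewrite -(ler_pM2l ac).
have -> : (c - a) * (l * C a + (1 - l) * C c) =
  l * (c - a) * C a + ((c - a) - l * (c - a)) * C c by ring.
by rewrite el; lra.
Qed.

Lemma convex_min_exists : exists y : R, forall x : R, C y <= C x.
Proof.
have [B BP] := coerC (C 0).
have [b [Bb b0]] : exists b : R, B <= b /\ 0 <= b.
  by exists (Num.max B 0); rewrite !le_max !lexx orbT.
have bb : - b <= b by lra.
(* The Lipschitz constant may be 0, so g + 1 serves as divisor. *)
have g1 : 0 < g + 1 by have := g0; lra.
have [||y yb ymin] := @EVT_min R C (- b) b.
- exact: bb.
- apply: continuous_subspaceT => x; apply/cvgrPdist_lt => e e0.
  near=> y; apply: le_lt_trans (lipC x y) _.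
  have xy : `|x - y| < e / (g + 1).
    by near: y; apply: cvgr_dist_lt => //; rewrite divr_gt0.
  rewrite ltr_pdivlMr// mulrDr mulr1 in xy.
  by rewrite mulrC; apply: le_lt_trans xy; rewrite lerDl.
exists y => x; have [xb|bx] := leP `|x| b.
  by apply: ymin; rewrite in_itv/= -ler_norml.
have Cy0 : C y <= C 0 by apply: ymin; rewrite in_itv/=; lra.
apply: le_trans Cy0 _; apply: BP; exact: le_trans Bb (ltW bx).
Unshelve. all: by end_near.
Qed.

Lemma min_set_has_inf : has_inf [set y : R | forall x, C y <= C x].
Proof.
split; first exact: convex_min_exists.
have [y0 y0P] := convex_min_exists; have [B BP] := coerC (C y0 + 1).
exists (- `|B|) => y /(_ y0) yy0; rewrite leNgt; apply/negP => yB.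
have : C y0 + 1 <= C y.
  by apply: BP; apply: le_trans (ler_norm B) _; rewrite ler_normr; apply/orP; right; lra.
lra.
Qed.

(** Minimisers come arbitrarily close to their infimum, and the Lipschitz bound carries the minimal
    value over to it. *)
Lemma argmin_le (x : R) : C m <= C x.
Proof.
have g1 : 0 < g + 1 by have := g0; lra.
apply/ler_addgt0Pr => e e0.
have [y yP ym] := inf_adherent (divr_gt0 e0 g1) min_set_has_inf.
have my : m <= y by apply: ge_inf => //; exact: min_set_has_inf.2.
have := lipC m y; rewrite (distrC m y) (ger0_norm (x := y - m)) ?subr_ge0// => Cmy.
have := yP x => yx.
have : g * (y - m) <= e.
  have : (g + 1) * (y - m) <= (g + 1) * (e / (g + 1)).
    by rewrite ler_pM2l//; lra.
  by rewrite mulrCA mulfV ?gt_eqF// mulr1 mulrDl mul1r; lra.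
by move: Cmy; rewrite ler_norml => /andP[_]; lra.
Qed.

(** Strictness comes from m being the least minimiser: a point left of m attaining the minimum would
    contradict it. *)
Lemma cost_decr (x y : R) : x < y -> y <= m -> C y < C x.
Proof.
move=> xy ym; have xm : C m < C x.
  rewrite lt_neqAle argmin_le andbT; apply/eqP => e.
  have : m <= x.
    by apply: ge_inf; [exact: min_set_has_inf.2|move=> z; rewrite -e; exact: argmin_le].
  by lra.
have [-> //|yNm] := eqVneq y m.
have {}ym : y < m by rewrite lt_neqAle yNm.
have := convex3 xy (ltW ym); have := argmin_le y => my h.
have : (m - y) * (C y - C x) <= 0.
  by apply: le_trans h _; rewrite mulr_ge0_le0 ?subr_ge0 ?(ltW xy)// subr_le0.
rewrite pmulr_rle0 ?subr_gt0// => yx.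
rewrite lt_neqAle -subr_le0 yx andbT; apply/eqP => e.
by move: h; rewrite e subrr mulr0 pmulr_rge0 ?subr_gt0// subr_ge0; lra.
Qed.

Lemma cost_incr (x y : R) : m <= x -> x <= y -> C x <= C y.
Proof.
move=> mx xy; have [<-|mNx] := eqVneq m x; first exact: argmin_le.
have {}mx : m < x by rewrite lt_neqAle mNx.
have := convex3 mx xy; have := argmin_le x => cx.
have : 0 <= (y - x) * (C x - C m) by rewrite mulr_ge0// subr_ge0.
move=> /le_trans/[apply]; rewrite pmulr_rge0 ?subr_gt0// subr_ge0//.
Qed.

End ConvexCost.

(* Division-free form: K + f c lies above the chord through a and b prolonged to c. *)
Definition kconvex (R : realType) (X : set R) (K : R) (f : R -> R) : Prop :=
  forall a b c : R, X a -> X b -> X c -> a < b -> b <= c ->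
    (c - b) * (f b - f a) <= (b - a) * (K + f c - f b).

Section KConvexValue.
Variables (R : realType) (X : set R) (K : R) (H : R -> R) (S s : R).
Hypothesis K0 : 0 <= K.
Hypothesis kH : kconvex X K H.
Hypothesis XS : X S.
Hypothesis Xs : X s.
Hypothesis sS : s <= S.
Hypothesis HsS : H s <= H S + K.
Hypothesis minS : forall z, X z -> H S <= H z.
Local Notation V := (fun y => if y < s then H S + K else H y).

(** If H exceeded H S + K at z, the chord from s through z, prolonged to S, would rise above K + H
    S. *)
Lemma kconvex_mid (z : R) : X z -> s <= z <= S -> H z <= H S + K.
Proof.
have K0' := K0; have HsS' := HsS; have sS' := sS.
move=> Xz /andP[sz zS]; have [<- //|sNz] := eqVneq s z.
have {}sz : s < z by rewrite lt_neqAle sNz.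
rewrite leNgt; apply/negP => lt; have := kH Xs Xz XS sz zS.
have : 0 <= (S - z) * (H z - H s) by rewrite mulr_ge0 ?subr_ge0//; lra.
move=> /le_trans/[apply]; rewrite pmulr_rge0 ?subr_gt0//; lra.
Qed.

Lemma kconvex_reorder (a b : R) : X a -> X b -> s <= a -> a <= b -> H a <= K + H b.
Proof.
have K0' := K0; have HsS' := HsS; have sS' := sS.
move=> Xa Xb sa ab; have [aS|Sa] := leP a S.
  by apply: le_trans (kconvex_mid Xa _) _; rewrite ?sa// addrC lerD2l minS.
have := kH XS Xa Xb Sa ab.
have : 0 <= (b - a) * (H a - H S) by rewrite mulr_ge0 ?subr_ge0// minS.
by move=> /le_trans/[apply]; rewrite pmulr_rge0 ?subr_gt0//; lra.
Qed.

Lemma value_leK (a b : R) : X a -> X b -> a <= b -> V a <= V b + K.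
Proof.
have K0' := K0; have HsS' := HsS; have sS' := sS.
move=> Xa Xb ab /=; have := minS Xb; case: (ltP a s) => sa; case: (ltP b s) => sb; try lra.
by have := kconvex_reorder Xa Xb sa ab; lra.
Qed.

(** The delicate case is a < s <= b, where V a = H S + K. If H b is at most this, the two sides have
    opposite signs. Otherwise b lies beyond S by [kconvex_mid], and the inequality for S, b, c
    suffices since b - S <= b - a. *)
Lemma value_kconvex : kconvex X K V.
Proof.
have K0' := K0; have HsS' := HsS; have sS' := sS.
move=> a b c Xa Xb Xc ab bc /=.
have [bs|sb] := ltP b s.
  rewrite (lt_trans ab bs) subrr mulr0 mulr_ge0 ?subr_ge0 ?(ltW ab)//.
  by have := minS Xc; case: ifP; lra.
have -> : (c < s) = false by rewrite ltNge (le_trans sb bc).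
have [as'|sa] := ltP a s; last exact: kH.
have [bS|Sb] := leP (H b) (H S + K).
  have := minS Xc => Sc; apply: (@le_trans _ _ 0).
    by rewrite mulr_ge0_le0 ?subr_ge0//; lra.
  by rewrite mulr_ge0 ?subr_ge0 ?(ltW ab)//; lra.
have {}Sb : S < b.
  by rewrite ltNge; apply/negP => bS; have := kconvex_mid Xb; rewrite sb bS => /(_ isT); lra.
have := kH XS Xb Xc Sb bc; have := minS Xb => Sb'.
have p0 : 0 <= (c - b) * (H b - H S) by rewrite mulr_ge0 ?subr_ge0.
move=> h; have q0 : 0 <= K + H c - H b.
  by move: (le_trans p0 h); rewrite pmulr_rge0 ?subr_gt0.
have : (b - S) * (K + H c - H b) <= (b - a) * (K + H c - H b).
  by apply: ler_wpM2r => //; lra.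
move=> /(le_trans h) /(le_trans _); apply.
by apply: ler_wpM2l; lra.
Qed.

End KConvexValue.

Record grid_model (R : realType) (M : invModel R) (sT1 : R) (gamma : nat -> R) (th : R)
    : Prop := GridModel {
  gm_th : 0 < th;
  gm_T : (3 <= horizon M)%N;
  gm_disc : 0 < disc M <= 1;
  gm_setup0 : forall t, (t < horizon M)%N -> 0 <= setup M t;
  gm_setup : forall t, (t.+1 < horizon M)%N -> disc M * setup M t.+1 <= setup M t;
  gm_P0 : forall t, (t < horizon M)%N -> demand M t `]-oo, 0[ = 0%E;
  gm_mean : forall t, (t < horizon M)%N -> integ M t (fun d => d);
  gm_convex : forall t, (t < horizon M)%N -> forall x y l : R, 0 <= l <= 1 ->
     Cfun M t (l * x + (1 - l) * y) <= l * Cfun M t x + (1 - l) * Cfun M t y;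
  gm_coercive : forall t, (t < horizon M)%N -> forall A : R, exists B : R,
     forall y : R, B <= `|y| -> A <= Cfun M t y;
  gm_sT1_le : sT1 <= Cmin M (horizon M).-1;
  gm_sT1 : Cfun M (horizon M).-1 sT1
    = Cfun M (horizon M).-1 (Cmin M (horizon M).-1) + setup M (horizon M).-1;
  gm_vopt : forall t, (t < horizon M)%N -> forall y : R,
     integ M t (fun d => vopt M t.+1 (y - d));
  gm_vpi : forall t, (t < horizon M)%N -> forall y : R,
     integ M t (fun d => vpi M th sT1 t.+1 (y - d));
  gm_lip : forall t, (t < horizon M)%N ->
     0 <= gamma t /\ forall x y : R, `|Cfun M t x - Cfun M t y| <= gamma t * `|x - y| }.

(** * Optimality of (s_t, S_t) on the grid, by backward induction *)

Section Stages.
Variables (R : realType) (M : invModel R) (sT1 : R) (gamma : nat -> R) (th : R).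
Hypothesis ok : grid_model M sT1 gamma th.
Local Notation T := (horizon M).
Local Notation alpha := (disc M).
Local Notation K := (setup M).
Local Notation C := (Cfun M).
Local Notation m := (Cmin M).
Local Notation SU := (SU M th).
Local Notation H := (Hf M th sT1).
Local Notation S := (Sg M th sT1).
Local Notation s := (sg M th sT1).
Local Notation Ib := (Ibar M th sT1).
Local Notation V := (Vfun M th sT1).
Local Notation grid := (onGrid th).
Local Notation E := (expect M).
Local Notation rd := (rd th).
Local Notation zn0 t := (gmaxlt th (m t)).

Let th0 := gm_th ok.

Lemma last_lt : (T.-1 < T)%N.
Proof. by have := gm_T ok; lia. Qed.

Lemma gamma_ge0 t : (t < T)%N -> 0 <= gamma t.
Proof. by move=> tT; have [] := gm_lip ok tT. Qed.

Lemma C_lip t (x y : R) : (t < T)%N -> `|C t x - C t y| <= gamma t * `|x - y|.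
Proof. by move=> tT; have [_] := gm_lip ok tT. Qed.

Lemma alpha_ge0 : 0 <= alpha.
Proof. by case/andP: (gm_disc ok) => /ltW. Qed.

Lemma C_convex3 t (a b c : R) : (t < T)%N -> a < b -> b <= c ->
  (c - b) * (C t b - C t a) <= (b - a) * (C t c - C t b).
Proof. by move=> tT; exact: (@convex3 _ (C t) (fun x y l => @gm_convex _ _ _ _ _ ok t tT x y l)). Qed.

Lemma C_min t (x : R) : (t < T)%N -> C t (m t) <= C t x.
Proof.
move=> tT; exact: (argmin_le (gm_coercive ok tT) (gamma_ge0 tT) (fun x y => C_lip x y tT)).
Qed.

Lemma C_decr t (x y : R) : (t < T)%N -> x < y -> y <= m t -> C t y < C t x.
Proof.
move=> tT; exact: (cost_decr (gm_convex ok tT) (gm_coercive ok tT) (gamma_ge0 tT)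
  (fun x y => C_lip x y tT)).
Qed.

Lemma C_incr t (x y : R) : (t < T)%N -> m t <= x -> x <= y -> C t x <= C t y.
Proof.
move=> tT; exact: (cost_incr (gm_convex ok tT) (gm_coercive ok tT) (gamma_ge0 tT)
  (fun x y => C_lip x y tT)).
Qed.

Lemma SU_spec t : (t < T)%N ->
  [/\ grid (SU t), m t <= SU t & C t (zn0 t) + K t < C t (SU t)].
Proof.
move=> tT; have [||| [gS [mS CS]] _] := @grid_inf_mem _ _ th0
    [set z | grid z /\ m t <= z /\ C t (zn0 t) + K t < C t z].
- by move=> ? [].
- have [B BP] := gm_coercive ok tT (C t (zn0 t) + K t + 1).
  exists (gceil th (Num.max (m t) B)); split; first exact: gceil_grid.
  have := le_gceil th0 (Num.max (m t) B); rewrite ge_max => /andP[mg Bg].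
  split=> //; have : C t (zn0 t) + K t + 1 <= C t (gceil th (Num.max (m t) B)).
    by apply: BP; apply: le_trans Bg (ler_norm _).
  by apply: lt_le_trans; rewrite ltrDl.
- by exists (m t) => z [_ []].
- by split.
Qed.

Lemma zn0_spec t : [/\ grid (zn0 t), zn0 t < m t & m t <= zn0 t + th].
Proof. exact: gmaxltP. Qed.

Lemma zn0_lt_SU t : (t < T)%N -> zn0 t < SU t.
Proof.
by move=> tT; have [_ mS _] := SU_spec tT; have [_ zm _] := zn0_spec t; exact: lt_le_trans mS.
Qed.

(** Right of the minimiser C_t is nondecreasing; between z_{n_0} and the minimiser it is at most its
    value at z_{n_0}, hence below its value at S^U_t. *)
Lemma C_le_of_SU t (x y : R) : (t < T)%N -> zn0 t <= x -> x <= y -> SU t <= y ->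
  C t x <= C t y.
Proof.
move=> tT zx xy Sy; have [xm|mx] := leP x (m t); last exact: C_incr (ltW mx) xy.
have [_ mS CS] := SU_spec tT; have K0 := gm_setup0 ok tT.
have CSy := C_incr tT mS Sy.
have : C t x <= C t (zn0 t).
  by move: zx; rewrite le_eqVlt => /predU1P[->//|zx]; rewrite ltW// C_decr.
by lra.
Qed.

Lemma V_evcst t : evcst (V t).
Proof.
by exists (s t), (H t (S t) + K t) => z zs; rewrite /Vfun /Vof -/(sg _ _ _ _) zs.
Qed.

Lemma gst_last : gst M th sT1 T.-1 = Stage (C T.-1) (m T.-1) sT1 sT1.
Proof. by rewrite /gst subnn. Qed.

Definition Igrid t := gmaxlt th (Num.min (Ib t.+1 - th) (m t)).

Lemma Hf_step t (y : R) : (t.+1 < T)%N ->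
  H t y = C t y + alpha * E t (fun d => V t.+1 (y - rd d)).
Proof.
move=> tT; rewrite -(gsum_expect (gm_P0 ok (step_lt tT)) th0 _ (V_evcst t.+1)).
by rewrite /Hf /gst gst_rank//= !stage_index.
Qed.

Lemma Hf_fun t : (t.+1 < T)%N -> Hf M th sT1 t =
  fun y => C t y + alpha * gsum (fun n => V t.+1 (y - zg th n) * fmass M th t n).
Proof. by move=> tT; rewrite /Hf /gst gst_rank//= !stage_index. Qed.

Lemma Ibar_step t : (t.+1 < T)%N ->
  Ib t = sup [set z | grid z /\ z <= Igrid t /\ C t (Igrid t) + K t < C t z] + th.
Proof. by move=> tT; rewrite /Ibar /gst gst_rank//= !stage_index. Qed.

Lemma Sg_step t : (t.+1 < T)%N ->
  S t = sup [set z | grid z /\ Igrid t <= z <= SU t /\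
                   (forall w, grid w -> Igrid t <= w <= SU t -> H t z <= H t w)].
Proof. by move=> tT; rewrite Hf_fun// /Sg /gst gst_rank//= !stage_index. Qed.

Lemma sg_step t : (t.+1 < T)%N ->
  s t = if K t == 0 then S t
        else inf [set z | grid z /\ Ib t <= z <= S t /\ H t z <= H t (S t) + K t].
Proof.
move=> tT; rewrite [in RHS]Sg_step// Ibar_step// Hf_fun//.
by rewrite /sg /gst gst_rank//= !stage_index.
Qed.

(* s_(T-1) and S_(T-1) need not be grid points: at the last stage every point is admitted. *)
Definition live t : set R := [set z | (t.+1 < T)%N -> grid z].

(** The induction invariant: the hypotheses of the (s, S) lemmas above, together with two facts
    about the region left of s_t. [sp_Ibs] makes V_t constant left of the search bound used at stage
    t - 1, and [sp_below] at s_t - th bounds the drop of V_t at s_t. *)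
Record stage_spec t : Prop := StageSpec {
  sp_live_s : live t (s t);
  sp_live_S : live t (S t);
  sp_sS : s t <= S t;
  sp_Ibs : Ib t <= s t;
  sp_HsS : H t (s t) <= H t (S t) + K t;
  sp_minS : forall z : R, live t z -> H t (S t) <= H t z;
  sp_below : forall z : R, live t z -> z < s t -> H t (S t) + K t <= H t z;
  sp_kconvex : kconvex (live t) (K t) (H t) }.

Lemma grid_live t (z : R) : grid z -> live t z.
Proof. by move=> gz _. Qed.

Lemma V_ltE t (y : R) : y < s t -> V t y = H t (S t) + K t.
Proof. by move=> ys; rewrite /Vfun /Vof -/(sg _ _ _ _) ys. Qed.

Lemma V_geE t (y : R) : s t <= y -> V t y = H t y.
Proof. by move=> sy; rewrite /Vfun /Vof -/(sg _ _ _ _) ltNge sy. Qed.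

Lemma stage_spec_last : stage_spec T.-1.
Proof.
have Hl : H T.-1 = C T.-1 by rewrite /Hf gst_last.
have Sl : S T.-1 = m T.-1 by rewrite /Sg gst_last.
have sl : s T.-1 = sT1 by rewrite /sg gst_last.
have Il : Ib T.-1 = sT1 by rewrite /Ibar gst_last.
have lv z : live T.-1 z by move=> ?; lia.
have K0 := gm_setup0 ok last_lt.
split; rewrite ?Hl ?Sl ?sl ?Il//.
- exact: (gm_sT1_le ok).
- by rewrite (gm_sT1 ok).
- by move=> z _; exact: C_min last_lt.
- move=> z _ zs; rewrite -(gm_sT1 ok) ltW//.
  exact: C_decr last_lt zs (gm_sT1_le ok).
- move=> a b c _ _ _ ab bc; apply: le_trans (C_convex3 last_lt ab bc) _.
  by apply: ler_wpM2l; lra.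
Qed.

Section Step.
Variable t : nat.
Hypothesis tT : (t.+1 < T)%N.
Hypothesis spec : stage_spec t.+1.

Let t1T : (t < T)%N := step_lt tT.

Lemma Igrid_spec : [/\ grid (Igrid t), Igrid t < Ib t.+1 - th & Igrid t < m t].
Proof.
have [gI + _] := gmaxltP th0 (Num.min (Ib t.+1 - th) (m t)).
by rewrite -/(Igrid t) lt_min => /andP[].
Qed.

(** A rounded demand may be -th and raise the inventory by one cell. Because I_t lies below the next
    search bound minus th, y - rd d still falls left of s_{t+1}, where V_{t+1} is constant. *)
Lemma H_below_Igrid (y : R) : y <= Igrid t ->
  H t y = C t y + alpha * (H t.+1 (S t.+1) + K t.+1).
Proof.
move=> yI; have [_ II _] := Igrid_spec; have Is := sp_Ibs spec.
rewrite Hf_step//; congr (_ + _ * _); apply/le_anti.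
have iV := integ_rd (gm_P0 ok t1T) th0 y (V_evcst t.+1).
have e d : 0 <= d -> V t.+1 (y - rd d) = H t.+1 (S t.+1) + K t.+1.
  by move=> d0; rewrite V_ltE//; have [_ _ ?] := rdP th0 d0; lra.
rewrite (expect_le_cst (gm_P0 ok t1T) iV) => [|d d0]; last by rewrite e.
by rewrite (expect_ge_cst (gm_P0 ok t1T) iV)// => d d0; rewrite e.
Qed.

Lemma H_decr_Igrid (x y : R) : x < y -> y <= Igrid t -> H t y < H t x.
Proof.
move=> xy yI; have [_ _ Im] := Igrid_spec.
rewrite !H_below_Igrid//; last exact: le_trans (ltW xy) yI.
by rewrite ltrD2r C_decr// (le_trans yI)// ltW.
Qed.

Lemma Igrid_le_SU : Igrid t <= SU t.
Proof.
by have [_ mS _] := SU_spec t1T; have [_ _ Im] := Igrid_spec; exact: le_trans (ltW Im) mS.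
Qed.

Lemma Sg_spec : [/\ grid (S t), Igrid t <= S t, S t <= SU t &
  forall w, grid w -> Igrid t <= w <= SU t -> H t (S t) <= H t w].
Proof.
have [gI _ _] := Igrid_spec; have [gSU _ _] := SU_spec t1T.
have [z [gz zI hz]] := grid_argmin th0 (H t) gI gSU Igrid_le_SU.
rewrite Sg_step//.
have [||| [gS [/andP[IS SS] hS]] _] := @grid_sup_mem _ _ th0
  [set z | grid z /\ Igrid t <= z <= SU t /\
     (forall w, grid w -> Igrid t <= w <= SU t -> H t z <= H t w)].
- by move=> ? [].
- by exists z.
- by exists (SU t) => w [_ [/andP[]]].
- by split.
Qed.

Lemma Vnext_leK (a b : R) : grid a -> grid b -> a <= b -> V t.+1 a <= V t.+1 b + K t.+1.
Proof.
move=> ga gb ab; exact (value_leK (gm_setup0 ok tT) (sp_kconvex spec) (sp_live_S spec)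
  (sp_live_s spec) (sp_sS spec) (sp_HsS spec) (sp_minS spec) (grid_live (t := t.+1) ga) (grid_live (t := t.+1) gb) ab).
Qed.

Lemma Vnext_kconvex : kconvex grid (K t.+1) (V t.+1).
Proof.
move=> a b c ga gb gc; have := @value_kconvex _ _ _ _ _ _ (gm_setup0 ok tT) (sp_kconvex spec) (sp_live_S spec)
  (sp_live_s spec) (sp_sS spec) (sp_HsS spec) (sp_minS spec) a b c.
by apply; exact: grid_live.
Qed.

Lemma EVnext_leK (a b : R) : grid a -> grid b -> a <= b ->
  alpha * E t (fun d => V t.+1 (a - rd d)) <= alpha * E t (fun d => V t.+1 (b - rd d)) + K t.
Proof.
move=> ga gb ab.
have i y := integ_rd (gm_P0 ok t1T) th0 y (V_evcst t.+1).
apply: (@le_trans _ _ (alpha * (E t (fun d => V t.+1 (b - rd d)) + K t.+1))); last first.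
  by rewrite mulrDr lerD2l (gm_setup ok tT).
rewrite ler_wpM2l ?alpha_ge0// -[X in _ + X](expect_cst M t) -expectD//; last exact: integ_cst.
apply: (expect_le (gm_P0 ok t1T)) => //; first by apply: integD => //; exact: integ_cst.
move=> d _; have gd := rd_grid th d.
by apply: Vnext_leK; rewrite ?lerD2r//; exact: gridB.
Qed.

(** The search interval loses nothing. Left of I_t the function decreases; right of S^U_t the point
    z_{n_0} is better, as C_t there is smaller by more than K_t and [EVnext_leK] limits the loss in
    future cost to K_t. *)
Lemma H_min_grid (z : R) : grid z -> H t (S t) <= H t z.
Proof.
move=> gz; have [gS IS SS hS] := Sg_spec; have [gI _ Im] := Igrid_spec.
have hI : H t (S t) <= H t (Igrid t) by apply: hS; rewrite // lexx Igrid_le_SU.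
have [zI|Iz] := ltP z (Igrid t); first by apply: le_trans hI (ltW (H_decr_Igrid zI (lexx _))).
have [zS|Sz] := leP z (SU t); first by apply: hS; rewrite // Iz.
have [gz0 zm mz] := zn0_spec t; have zSU := zn0_lt_SU t1T.
apply: (@le_trans _ _ (H t (zn0 t))).
  apply: hS => //; rewrite (ltW zSU) andbT.
  by apply: (grid_le_of_lt th0 gI gz0); exact: lt_le_trans Im mz.
rewrite !Hf_step//; have := EVnext_leK gz0 gz (ltW (lt_trans zSU Sz)).
have [_ mS] := SU_spec t1T; have := C_incr t1T mS (ltW Sz); lra.
Qed.

(** Translation by a rounded demand preserves the grid, so V_{t+1} is K_{t+1}-convex along every
    translate. Averaging, discounting and adding the convex C_t give constant alpha K_{t+1} <=
    K_t. *)
Lemma H_kconvex_grid : kconvex grid (K t) (H t).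
Proof.
move=> a b c ga gb gc ab bc.
have i y : integ M t (fun d => V t.+1 (y - rd d)).
  exact: (integ_rd (gm_P0 ok t1T) th0 y (V_evcst t.+1)).
pose e y := E t (fun d => V t.+1 (y - rd d)).
have h : (c - b) * (e b - e a) <= (b - a) * (K t.+1 + e c - e b).
  have ic := integ_cst M t (K t.+1).
  have il : integ M t (fun d => V t.+1 (b - rd d) - V t.+1 (a - rd d)) by exact: integB.
  have icc : integ M t (fun d => K t.+1 + V t.+1 (c - rd d)) by exact: integD.
  have ir : integ M t (fun d => K t.+1 + V t.+1 (c - rd d) - V t.+1 (b - rd d)).
    exact: integB.
  have -> : e b - e a = E t (fun d => V t.+1 (b - rd d) - V t.+1 (a - rd d)).
    by rewrite expectB.
  have -> : K t.+1 + e c - e b = E t (fun d => K t.+1 + V t.+1 (c - rd d) - V t.+1 (b - rd d)).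
    by rewrite expectB// expectD// expect_cst.
  rewrite -!expectZ//; apply: (expect_le (gm_P0 ok t1T)); [exact: integZ|exact: integZ|].
  move=> d _; have := @Vnext_kconvex (a - rd d) (b - rd d) (c - rd d).
  have -> : c - rd d - (b - rd d) = c - b by ring.
  have -> : b - rd d - (a - rd d) = b - a by ring.
  by apply; rewrite ?ltrD2r ?lerD2r//; apply: gridB => //; exact: rd_grid.
have := C_convex3 t1T ab bc; rewrite !Hf_step// -!/(e _).
have := ler_wpM2l alpha_ge0 h.
have : (b - a) * (alpha * K t.+1) <= (b - a) * K t.
  by apply: ler_wpM2l; [lra|exact: (gm_setup ok)].
by lra.
Qed.

(** Left of I_t, H_t differs from C_t by a constant and decreases. Hence the test on C_t defining
    the search bound is a test on H_t, and it holds at all grid points further left. *)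
Lemma Ibar_spec : [/\ grid (Ib t), Ib t <= Igrid t &
  forall z, grid z -> z < Ib t -> H t (S t) + K t <= H t z].
Proof.
have [gI _ Im] := Igrid_spec; have K0 := gm_setup0 ok t1T.
have [gS IS SS hS] := Sg_spec.
have hI : H t (S t) <= H t (Igrid t) by apply: hS; rewrite // lexx Igrid_le_SU.
have th0' := th0.
rewrite Ibar_step//.
have [||| [gw [wI Cw]] ub] := @grid_sup_mem _ _ th0
    [set z | grid z /\ z <= Igrid t /\ C t (Igrid t) + K t < C t z].
- by move=> ? [].
- have [B BP] := gm_coercive ok t1T (C t (Igrid t) + K t + 1).
  exists (gceil th (Num.min (Igrid t) (- `|B|)) - th).
  have := gceil_lt th0 (Num.min (Igrid t) (- `|B|)).
  have : Num.min (Igrid t) (- `|B|) <= Igrid t by rewrite ge_min lexx.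
  have : Num.min (Igrid t) (- `|B|) <= - `|B| by rewrite ge_min lexx orbT.
  set mi := Num.min _ _ => h1 h2 h3.
  have h4 : C t (Igrid t) + K t + 1 <= C t (gceil th mi - th).
    apply: BP; apply: le_trans (ler_norm B) _; rewrite ler_normr; apply/orP; right.
    by lra.
  split; first by apply: gridBth; exact: gceil_grid.
  by split; lra.
- by exists (Igrid t) => z [_ []].
set w := sup _ in gw wI Cw ub *.
have wI' : w < Igrid t.
  by rewrite lt_neqAle wI andbT; apply/eqP => e; move: Cw; rewrite e; lra.
split; [exact: gridDth|exact: grid_lt_le|].
move=> z gz zw; have {zw} zw : z <= w := grid_le_of_lt th0 gz gw zw.
have Hz : H t w <= H t z.
  by move: zw; rewrite le_eqVlt => /predU1P[->//|zw]; rewrite ltW// H_decr_Igrid.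
apply: le_trans Hz; apply: (@le_trans _ _ (H t (Igrid t) + K t)); first by rewrite lerD2r.
by rewrite !H_below_Igrid//; lra.
Qed.

Lemma stage_spec_step : stage_spec t.
Proof.
have [gI _ Im] := Igrid_spec; have K0 := gm_setup0 ok t1T.
have [gS IS SS hS] := Sg_spec; have [gB BI below] := Ibar_spec.
have lv z : live t z -> grid z by apply.
have [K0'|KN0] := eqVneq (K t) 0.
  have es : s t = S t by rewrite sg_step// K0' eqxx.
  split; rewrite ?es //.
  - exact: le_trans BI IS.
  - by rewrite K0' addr0.
  - by move=> z /lv; exact: H_min_grid.
  - by move=> z /lv gz _; rewrite K0' addr0 H_min_grid.
  - by move=> a b c /lv ga /lv gb /lv gc; exact: H_kconvex_grid.
have es : s t = inf [set z | grid z /\ Ib t <= z <= S t /\ H t z <= H t (S t) + K t].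
  by rewrite sg_step// (negbTE KN0).
have [||| [gs [/andP[Bs sS] Hs]] lb] := @grid_inf_mem _ _ th0
    [set z | grid z /\ Ib t <= z <= S t /\ H t z <= H t (S t) + K t].
- by move=> ? [].
- by exists (S t); do !split=> //; rewrite ?lexx ?andbT ?(le_trans BI)// lerDl.
- by exists (Ib t) => z [_ [/andP[]]].
rewrite -es in gs Bs sS Hs lb.
split=> //.
- by move=> z /lv; exact: H_min_grid.
- move=> z /lv gz zs; have [zB|Bz] := ltP z (Ib t); first exact: below.
  rewrite leNgt; apply/negP => lt.
  have : s t <= z by apply: lb; split=> //; rewrite Bz (le_trans (ltW zs))// ltW.
  by rewrite leNgt zs.
- by move=> a b c /lv ga /lv gb /lv gc; exact: H_kconvex_grid.
Qed.

End Step.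

Lemma stage_specP t : (t < T)%N -> stage_spec t.
Proof.
apply: downward_ind; [by have := gm_T ok; lia|exact: stage_spec_last|].
by move=> u uT; exact: stage_spec_step.
Qed.

End Stages.

(** * The functions psi and phi as moduli of continuity of H and V *)

Section Modulus.
Variables (R : realType) (M : invModel R) (sT1 : R) (gamma : nat -> R) (th : R).
Hypothesis ok : grid_model M sT1 gamma th.
Local Notation T := (horizon M).
Local Notation alpha := (disc M).
Local Notation K := (setup M).
Local Notation C := (Cfun M).
Local Notation m := (Cmin M).
Local Notation H := (Hf M th sT1).
Local Notation S := (Sg M th sT1).
Local Notation s := (sg M th sT1).
Local Notation V := (Vfun M th sT1).
Local Notation grid := (onGrid th).
Local Notation E := (expect M).
Local Notation rd := (rd th).

Let th0 := gm_th ok.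

Lemma alphaE_diff_le t (F G h : R -> R) : (t < T)%N ->
  integ M t F -> integ M t G -> integ M t h ->
  (forall d : R, 0 <= d -> F d - G d <= h d) -> alpha * E t F - alpha * E t G <= alpha * E t h.
Proof.
move=> tT iF iG ih FG; rewrite -mulrBr -expectB// ler_wpM2l ?(alpha_ge0 ok)//.
by apply: (expect_le (gm_P0 ok tT)) => //; exact: integB.
Qed.

Lemma integ_V t u (y : R) : (t < T)%N -> integ M t (fun d => V u (y - rd d)).
Proof. by move=> tT; exact: (integ_rd (gm_P0 ok tT) th0 y (V_evcst M sT1 th u)). Qed.

(* [b = false] gives psi and phi, [b = true] their barred versions. *)
Definition Psi b t := (psirev M th sT1 gamma b (T.-1 - t)).1.
Definition Phi b t := (psirev M th sT1 gamma b (T.-1 - t)).2.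

Lemma Psi_last b (x y : R) : Psi b T.-1 x y = gamma T.-1 * x.
Proof. by rewrite /Psi subnn. Qed.

Lemma Phi_last b (x y : R) : Phi b T.-1 x y = if y < s T.-1 then 0 else gamma T.-1 * x.
Proof. by rewrite /Phi subnn. Qed.

Lemma Phi_step b t (x y : R) : (t.+1 < T)%N -> s t <= y -> Phi b t x y =
  if y - x < s t then Psi b t (y - s t + (if b then th else 0)) y else Psi b t x y.
Proof.
move=> tT sy; rewrite /Phi /Psi gst_rank//= stage_index//.
by rewrite (ltNge y) sy.
Qed.

Lemma Phi_lt b t (x y : R) : (t < T)%N -> y < s t -> Phi b t x y = 0.
Proof.
move=> /ltn_last_or[->|tT] ys; first by rewrite Phi_last ys.
by rewrite /Phi gst_rank//= stage_index// ys.
Qed.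

Lemma Phi_evcst b t (x : R) : (t < T)%N -> evcst (Phi b t x).
Proof. by move=> tT; exists (s t), 0 => z; exact: Phi_lt. Qed.

Lemma integ_Phi b t u (x y : R) : (t < T)%N -> (u < T)%N ->
  integ M t (fun d => Phi b u x (y - rd d)).
Proof. by move=> tT uT; exact: (integ_rd (gm_P0 ok tT) th0 y (Phi_evcst b x uT)). Qed.

(** Since phi vanishes left of s_{t+1}, both the case distinction and the cut-off of the sum in the
    definition of psi discard only zero terms. *)
Lemma Psi_step b t (x y : R) : (t.+1 < T)%N ->
  Psi b t x y = gamma t * x + alpha * E t (fun d => Phi b t.+1 x (y - rd d)).
Proof.
move=> tT; have P0 := gm_P0 ok (step_lt tT); rewrite /Psi gst_rank//= stage_index//.
rewrite -/(Phi b t.+1).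
have [ys|sy] := ltP y (s t.+1 - th).
  suff -> : E t (fun d => Phi b t.+1 x (y - rd d)) = 0 by rewrite mulr0 addr0.
  have iP := integ_Phi b x y (step_lt tT) tT.
  have z d : 0 <= d -> Phi b t.+1 x (y - rd d) = 0.
    by move=> d0; rewrite Phi_lt//; have [_ _ ?] := rdP th0 d0; lra.
  apply/le_anti; rewrite (expect_le_cst P0 iP) => [|d d0]; last by rewrite z.
  by rewrite (expect_ge_cst P0 iP)// => d d0; rewrite z.
congr (_ + alpha * _).
have := @integ_rd_fin _ _ _ P0 _ th0 (Phi b t.+1 x) y 0 (nidx th y (s t.+1)).+1.
case=> [k Nk|_ ->]; last by rewrite add0r; apply: eq_bigr => k _; rewrite subr0.
apply: Phi_lt => //; rewrite ltrBlDr -ltrBlDl.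
set q := (y - s t.+1) / th.
have q1 : -1 <= q by rewrite ler_pdivlMr// mulN1r; lra.
(* [nidx] takes an absolute value; it is the intended index only because y >= s_{t+1} - th makes
   this integer nonnegative. *)
have f0 : 0 <= Num.floor q + 1.
  have : -1 <= Num.floor q by rewrite floor_ge_int.
  by lia.
have qk : q < (k%:Z - 1)%:~R.
  apply: lt_le_trans (floorD1_gt q) _; rewrite ler_int.
  by move: Nk; rewrite /nidx -/q; move: f0; case: (Num.floor q + 1) => // n _ /=; lia.
by move: qk; rewrite /q ltr_pdivrMr.
Qed.

Lemma Psi_false0 t (y : R) : (t < T)%N -> Psi false t 0 y = 0.
Proof.
move=> tT; move: t tT y; apply: downward_ind => [|y|t tT IH y].
- by have := gm_T ok; lia.
- by rewrite Psi_last mulr0.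
rewrite Psi_step// mulr0 add0r.
have -> : (fun d => Phi false t.+1 0 (y - rd d)) = (fun=> 0).
  apply/funext => d; have [ys|sy] := ltP (y - rd d) (s t.+1); first by rewrite Phi_lt.
  have [e|t1T] := ltn_last_or tT; first by rewrite e Phi_last mulr0 if_same.
  by rewrite Phi_step// subr0 (ltNge (y - rd d)) sy IH.
by rewrite expect_cst mulr0.
Qed.

Local Notation p b t := (Psi b t th).
Local Notation f b t := (Phi b t th).

Lemma grid_s t : (t.+1 < T)%N -> grid (s t).
Proof. by move=> tT; apply: (sp_live_s (stage_specP ok (step_lt tT))). Qed.

(** A grid point right of s_t is at least one cell away, so with x = th the middle branch of phi is
    met on the grid at z = s_t alone. There the unbarred version is 0 and the barred one is bar psi,
    by [Phi_eq]. *)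
Lemma Phi_gt b t (z : R) : (t.+1 < T)%N -> grid z -> s t < z -> f b t z = p b t z.
Proof.
move=> tT gz sz; rewrite Phi_step ?ltW//.
by have := grid_lt_le th0 (grid_s tT) gz sz; rewrite -lerBrDr leNgt => /negbTE ->.
Qed.

Lemma Phi_eq b t : (t.+1 < T)%N -> f b t (s t) = if b then p b t (s t) else 0.
Proof.
move=> tT; rewrite Phi_step// ltrBlDr ltrDl th0 subrr add0r.
by case: b => //; rewrite Psi_false0 ?(step_lt tT).
Qed.

Definition Phi_order t : Prop :=
  [/\ forall b (z : R), grid z -> 0 <= f b t z,
      forall b (z z' : R), grid z -> grid z' -> z <= z' -> f b t z <= f b t z' &
      forall z : R, grid z -> f false t z <= f true t z].

Lemma Psi_order_of t : (t.+1 < T)%N -> Phi_order t.+1 ->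
  [/\ forall b (z : R), grid z -> gamma t * th <= p b t z,
      forall b (z z' : R), grid z -> grid z' -> z <= z' -> p b t z <= p b t z' &
      forall z : R, grid z -> p false t z <= p true t z].
Proof.
move=> tT [f0 fm ff]; have t0T := step_lt tT; have gr d := rd_grid th d.
have P0 := gm_P0 ok t0T; have a0 := alpha_ge0 ok.
split=> [b z gz|b z z' gz gz' zz'|z gz]; rewrite !Psi_step//.
- rewrite lerDl mulr_ge0//; apply: (expect_ge_cst P0); first exact: integ_Phi.
  by move=> d _; apply: f0; exact: gridB.
- rewrite lerD2l ler_wpM2l//; apply: (expect_le P0); [exact: integ_Phi|exact: integ_Phi|].
  by move=> d _; apply: fm; rewrite ?lerD2r//; exact: gridB.
- rewrite lerD2l ler_wpM2l//; apply: (expect_le P0); [exact: integ_Phi|exact: integ_Phi|].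
  by move=> d _; apply: ff; exact: gridB.
Qed.

Lemma Phi_orderP t : (t < T)%N -> Phi_order t.
Proof.
have th0' := th0.
apply: downward_ind => [||{}t tT IH].
- by have := gm_T ok; lia.
- have gth : 0 <= gamma T.-1 * th by rewrite mulr_ge0 ?(gamma_ge0 ok)// ?(last_lt ok)// ltW.
  split=> [b z _|b z z' _ _ zz'|z _]; rewrite !Phi_last//; first by case: ifP.
  by case: (ltP z) => zs; [case: ifP|rewrite ltNge (le_trans zs zz')].
have [pg pm pp] := Psi_order_of tT IH; have gs := grid_s tT.
have g0 : 0 <= gamma t * th by rewrite mulr_ge0 ?(gamma_ge0 ok) ?(step_lt tT)// ltW.
have p0 b z : grid z -> 0 <= p b t z by move=> /(pg b); exact: le_trans.
have fp b z : grid z -> 0 <= f b t z <= p b t z.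
  move=> gz; have [zs|sz|->] := ltgtP z (s t).
  - by rewrite Phi_lt ?(step_lt tT)// lexx p0.
  - by rewrite Phi_gt// lexx andbT p0.
  - by rewrite Phi_eq//; case: b; rewrite ?lexx ?andbT p0.
split=> [b z gz|b z z' gz gz' zz'|z gz].
- by case/andP: (fp b z gz).
- have [zs|sz|zs] := ltgtP z (s t).
  + by rewrite Phi_lt ?(step_lt tT)//; case/andP: (fp b z' gz').
  + by rewrite !Phi_gt ?(lt_le_trans sz)// pm.
  move: zz'; rewrite le_eqVlt => /predU1P[->//|zz'].
  rewrite (@Phi_gt b t z')//; last by rewrite -zs.
  by case/andP: (fp b z gz) => _ /le_trans -> //; rewrite pm// ltW.
- have [zs|sz|zs] := ltgtP z (s t).
  + by rewrite !Phi_lt ?(step_lt tT).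
  + by rewrite !Phi_gt// pp.
  + by rewrite zs !Phi_eq// p0.
Qed.

Lemma Phi_ge0 b t (z : R) : (t < T)%N -> grid z -> 0 <= f b t z.
Proof. by move=> /Phi_orderP[+ _ _]; apply. Qed.

Lemma Phi_mono b t (z z' : R) : (t < T)%N -> grid z -> grid z' -> z <= z' -> f b t z <= f b t z'.
Proof. by move=> /Phi_orderP[_ + _]; apply. Qed.

Lemma Phi_falseW t (z : R) : (t < T)%N -> grid z -> f false t z <= f true t z.
Proof. by move=> /Phi_orderP[_ _]; apply. Qed.

Lemma Psi_ge b t (z : R) : (t.+1 < T)%N -> grid z -> gamma t * th <= p b t z.
Proof. by move=> tT; have [+ _ _] := Psi_order_of tT (Phi_orderP tT); apply. Qed.

Lemma Psi_ge0 b t (z : R) : (t.+1 < T)%N -> grid z -> 0 <= p b t z.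
Proof.
move=> tT /(Psi_ge b tT); apply: le_trans.
by rewrite mulr_ge0 ?(gamma_ge0 ok) ?(step_lt tT)// ltW.
Qed.

Lemma Psi_mono b t (z z' : R) : (t.+1 < T)%N -> grid z -> grid z' -> z <= z' ->
  p b t z <= p b t z'.
Proof. by move=> tT; have [_ + _] := Psi_order_of tT (Phi_orderP tT); apply. Qed.

Lemma Psi_falseW t (z : R) : (t.+1 < T)%N -> grid z -> p false t z <= p true t z.
Proof. by move=> tT; have [_ _] := Psi_order_of tT (Phi_orderP tT); apply. Qed.

Lemma Phi_le_Psi b t (z : R) : (t.+1 < T)%N -> grid z -> f b t z <= p b t z.
Proof.
move=> tT gz; have p0 := Psi_ge0 b tT gz; have [zs|sz|zs] := ltgtP z (s t).
- by rewrite Phi_lt ?(step_lt tT).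
- by rewrite Phi_gt.
- by move: p0; rewrite zs Phi_eq//; case: b.
Qed.

(** At the last stage s solves the defining equation exactly, so V has no jump there and the barred
    and unbarred moduli coincide. *)
Lemma V_last (y : R) : V T.-1 y = C T.-1 (Num.max y (s T.-1)).
Proof.
have Hl : H T.-1 = C T.-1 by rewrite /Hf gst_last.
have Sl : S T.-1 = m T.-1 by rewrite /Sg gst_last.
have sl : s T.-1 = sT1 by rewrite /sg gst_last.
case: (ltP y (s T.-1)) => ys; last by rewrite V_geE// Hl.
by rewrite V_ltE// Hl Sl sl (gm_sT1 ok).
Qed.

Lemma V_last_lip (w u z : R) n : w <= u -> u <= z -> u - w <= n%:R * th ->
  `|V T.-1 w - V T.-1 u| <= n%:R * f false T.-1 z.
Proof.
move=> wu uz uwn; rewrite !V_last Phi_last.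
have lT := last_lt ok; have g0 := gamma_ge0 ok lT.
case: ifPn => [zs|].
  have us : u <= s T.-1 by lra.
  have ws : w <= s T.-1 by lra.
  by rewrite !max_r// subrr normr0 mulr0.
move=> _; apply: le_trans (C_lip ok _ _ lT) _.
rewrite mulrCA ler_wpM2l//; apply: le_trans uwn.
rewrite ler_norml /Num.max; case: ltP => ws; case: ltP => us; apply/andP; split; lra.
Qed.

(* V_t jumps only at s_t, by at most H_t(s_t - th) - H_t(s_t), i.e. by one cell. Over n+1
   cells this costs one barred modulus in total: crossing s_t extends the interval to the
   left by one cell, but at every stage at most one of the cells contains the jump. *)
Definition V_modulus_at t : Prop := forall (n : nat) (z w u : R), grid z ->
  z - n.+1%:R * th <= w -> w <= u -> z - th <= u -> u <= z ->
  `|V t w - V t u| <= n%:R * f false t z + f true t z.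

Lemma H_modulus_of t (n : nat) (z w u : R) : (t.+1 < T)%N -> V_modulus_at t.+1 -> grid z ->
  z - n.+1%:R * th <= w -> w <= u -> z - th <= u -> u <= z ->
  `|H t w - H t u| <= n%:R * p false t z + p true t z.
Proof.
move=> tT IH gz zw wu zu uz; have t0T := step_lt tT; have g0 := gamma_ge0 ok t0T.
rewrite !(Hf_step ok)// !Psi_step//.
have iV y := integ_V t.+1 y t0T.
have iP b := integ_Phi b th z t0T tT.
set ew := E t _; set eu := E t _.
have -> : n%:R * (gamma t * th + alpha * E t (fun d => f false t.+1 (z - rd d))) +
   (gamma t * th + alpha * E t (fun d => f true t.+1 (z - rd d))) =
   gamma t * (n.+1%:R * th) + alpha * E t (fun d => n%:R * f false t.+1 (z - rd d) + f true t.+1 (z - rd d)).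
  rewrite expectD//; last exact: integZ.
  by rewrite expectZ// -natr1; ring.
have iB : integ M t (fun d => n%:R * f false t.+1 (z - rd d) + f true t.+1 (z - rd d)).
  by apply: integD => //; exact: integZ.
have pt d : 0 <= d -> `|V t.+1 (w - rd d) - V t.+1 (u - rd d)| <=
    n%:R * f false t.+1 (z - rd d) + f true t.+1 (z - rd d).
  by move=> d0; apply: IH; [exact: gridB (rd_grid th d)|lra|lra|lra|lra].
have h1 : alpha * ew - alpha * eu <= alpha * E t (fun d => n%:R * f false t.+1 (z - rd d) + f true t.+1 (z - rd d)).
  apply: alphaE_diff_le => // d d0; exact: le_trans (ler_norm _) (pt d d0).
have h2 : alpha * eu - alpha * ew <= alpha * E t (fun d => n%:R * f false t.+1 (z - rd d) + f true t.+1 (z - rd d)).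
  apply: alphaE_diff_le => // d d0; apply: le_trans (ler_norm _) _.
  by rewrite distrC; exact: pt.
have h3 : `|C t w - C t u| <= gamma t * (n.+1%:R * th).
  apply: le_trans (C_lip ok _ _ t0T) _; rewrite ler_wpM2l// distrC ger0_norm ?subr_ge0//.
  by lra.
move: h3; rewrite !ler_norml => /andP[h3 h4]; apply/andP; split; lra.
Qed.

Lemma V_modulus_step t : (t.+1 < T)%N -> V_modulus_at t.+1 -> V_modulus_at t.
Proof.
move=> tT IH n z w u gz zw wu zu uz; have t0T := step_lt tT; have th0' := th0.
have sp := stage_specP ok t0T; have gs := grid_s tT.
have HsS := sp_HsS sp.
have RHS0 : 0 <= n%:R * f false t z + f true t z.
  by rewrite addr_ge0// ?mulr_ge0// Phi_ge0.
have [us|su] := ltP u (s t).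
  by rewrite !V_ltE ?(le_lt_trans wu)// subrr normr0.
have sz : s t <= z by exact: le_trans su uz.
have [ws|sw] := ltP w (s t); last first.
  move: sz; rewrite le_eqVlt => /predU1P[sz|sz].
    have eu : u = s t by apply/le_anti; rewrite su sz uz.
    have -> : w = u by apply/le_anti; rewrite wu eu sw.
    by rewrite subrr normr0.
  by rewrite !V_geE// !Phi_gt//; exact: H_modulus_of.
(* The constant value of V_t left of s_t lies between H_t(s_t) and H_t(s_t - th). So w may be
   replaced by one of these two points, depending on the sign of the difference. *)
have below : H t (S t) + K t <= H t (s t - th).
  by apply: (sp_below sp); [apply/grid_live/gridBth|lra].
rewrite V_ltE// V_geE//.
move: sz; rewrite le_eqVlt => /predU1P[sz|sz].
  have eu : u = s t by apply/le_anti; rewrite su sz uz.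
  rewrite -sz !Phi_eq// mulr0 add0r eu.
  have := @H_modulus_of t 0 (s t) (s t - th) (s t) tT IH gs.
  rewrite mul1r mul0r add0r => /(_ (lexx _) _ _ (lexx _)) h.
  have {}h : `|H t (s t - th) - H t (s t)| <= p true t (s t) by apply: h; lra.
  by move: h; rewrite !ler_norml => /andP[_ h]; apply/andP; split; lra.
have [k ek] := grid_stepsP th0 gs gz (ltW sz).
(* As w < s_t, at most n cells separate s_t from z, so the interval starting at s_t - th still fits
   into n + 1 cells. *)
have kn : (k <= n)%N.
  have : k%:R * th < n.+1%:R * th by lra.
  by rewrite ltr_pM2r// ltr_nat.
have k1 : z - k.+1%:R * th = s t - th by rewrite ek -natr1; ring.
have h1 := @H_modulus_of t k z (s t - th) u tT IH gz.
rewrite k1 in h1; have {}h1 := h1 (lexx _).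
have {}h1 : `|H t (s t - th) - H t u| <= k%:R * p false t z + p true t z by apply: h1; lra.
have h2 := @H_modulus_of t k z (s t) u tT IH gz.
rewrite k1 in h2.
have {}h2 : `|H t (s t) - H t u| <= k%:R * p false t z + p true t z by apply: h2; lra.
have h3 : k%:R * p false t z <= n%:R * p false t z.
  by rewrite ler_wpM2r ?Psi_ge0// ler_nat.
rewrite !Phi_gt//.
by move: h1 h2; rewrite !ler_norml => /andP[_ h1] /andP[h2 _]; apply/andP; split; lra.
Qed.

Lemma V_modulus t : (t < T)%N -> V_modulus_at t.
Proof.
apply: downward_ind => [|n z w u gz zw wu zu uz|]; last exact: V_modulus_step.
  by have := gm_T ok; lia.
have -> : n%:R * f false T.-1 z + f true T.-1 z = n.+1%:R * f false T.-1 z.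
  by rewrite -natr1 mulrDl mul1r !Phi_last.
by apply: V_last_lip => //; lra.
Qed.

Lemma H_modulus t (n : nat) (z w u : R) : (t.+1 < T)%N -> grid z ->
  z - n.+1%:R * th <= w -> w <= u -> z - th <= u -> u <= z ->
  `|H t w - H t u| <= n%:R * p false t z + p true t z.
Proof. by move=> tT; apply: H_modulus_of => //; exact: V_modulus. Qed.

End Modulus.

(** * One-sided increments, where the jump at s_t does no harm *)

Section Increments.
Variables (R : realType) (M : invModel R) (sT1 : R) (gamma : nat -> R) (th : R).
Hypothesis ok : grid_model M sT1 gamma th.
Local Notation T := (horizon M).
Local Notation alpha := (disc M).
Local Notation K := (setup M).
Local Notation C := (Cfun M).
Local Notation H := (Hf M th sT1).
Local Notation s := (sg M th sT1).
Local Notation V := (Vfun M th sT1).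
Local Notation grid := (onGrid th).
Local Notation E := (expect M).
Local Notation rd := (rd th).

Let th0 := gm_th ok.

Local Notation p b t := (Psi M sT1 gamma th b t th).
Local Notation f b t := (Phi M sT1 gamma th b t th).

(** Moving right across s_t the value can only drop, so a jump helps this bound. At z = s_t the
    increment is at most 0, the value of the unbarred phi there. *)
Definition V_up_at t : Prop := forall z w u : R, grid z ->
  z - th < u <= z -> u - th <= w <= u -> V t u - V t w <= f false t z.

Lemma H_up_of t (z w u : R) : (t.+1 < T)%N -> V_up_at t.+1 -> grid z ->
  z - th < u <= z -> u - th <= w <= u -> H t u - H t w <= p false t z.
Proof.
move=> tT IH gz /andP[zu uz] /andP[uw wu]; have t0T := step_lt tT.
rewrite !(Hf_step ok)// (Psi_step ok)//.
have h : alpha * E t (fun d => V t.+1 (u - rd d)) - alpha * E t (fun d => V t.+1 (w - rd d))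
    <= alpha * E t (fun d => f false t.+1 (z - rd d)).
  apply: (alphaE_diff_le ok) => // [|||d d0];
    [exact: (integ_V ok)|exact: (integ_V ok)|exact: (integ_Phi ok)|].
  by apply: IH; [exact: gridB (rd_grid th d)|apply/andP; split; lra|apply/andP; split; lra].
have := C_lip ok u w t0T; rewrite (ger0_norm (x := u - w)) ?subr_ge0//.
have : gamma t * (u - w) <= gamma t * th by rewrite ler_wpM2l ?(gamma_ge0 ok)//; lra.
by move=> h1 /(le_trans (ler_norm _)); lra.
Qed.

Lemma V_up t : (t < T)%N -> V_up_at t.
Proof.
have th0' := th0.
apply: downward_ind => [|z w u _ /andP[zu uz] /andP[uw wu]|{}t tT IH z w u gz zuz wu].
- by have := gm_T ok; lia.
- rewrite -[leRHS]mul1r; apply: le_trans (ler_norm _) _.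
  by rewrite distrC; apply: (V_last_lip ok (n := 1)); lra.
have t0T := step_lt tT; have gs := grid_s ok tT; have HsS := sp_HsS (stage_specP ok t0T).
have f0 := Phi_ge0 ok false t0T gz.
case/andP: (zuz) => zu uz; case/andP: (wu) => uw {}wu.
have [us|su] := ltP u (s t); first by rewrite !V_ltE ?(le_lt_trans wu)// subrr.
have [sz|zs|sz] := ltgtP (s t) z; last first.
- have -> : u = s t by apply/le_anti; rewrite su sz uz.
  rewrite (V_geE (lexx _)); have [ws|sw] := ltP w (s t).
    by rewrite V_ltE//; apply: le_trans f0; lra.
  by have -> : w = s t by [apply/le_anti; rewrite sw (le_trans wu)// sz]; rewrite V_geE// subrr.
- by move: (lt_le_trans zs (le_trans su uz)); rewrite ltxx.
rewrite (Phi_gt ok)// (V_geE su).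
have [ws|sw] := ltP w (s t); last by rewrite V_geE// H_up_of// uw.
rewrite V_ltE//; have : H t u - H t (s t) <= p false t z.
  by apply: H_up_of => //; apply/andP; split; lra.
by lra.
Qed.

Lemma H_up t (z w u : R) : (t.+1 < T)%N -> grid z ->
  z - th < u <= z -> u - th <= w <= u -> H t u - H t w <= p false t z.
Proof. by move=> tT; apply: H_up_of => //; exact: V_up. Qed.

(* On a half-open cell [z, z + th) no reordering jump can occur, since s_t is a grid point. *)
Definition V_down_at t : Prop := forall z r : R, grid z -> 0 <= r < th ->
  V t z - V t (z + r) <= f false t (z + th).

Lemma H_down_of t (z r : R) : (t.+1 < T)%N -> V_down_at t.+1 -> grid z -> 0 <= r < th ->
  H t z - H t (z + r) <= p false t (z + th).
Proof.
move=> tT IH gz rth; have t0T := step_lt tT.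
rewrite !(Hf_step ok)// (Psi_step ok)//.
have h : alpha * E t (fun d => V t.+1 (z - rd d)) - alpha * E t (fun d => V t.+1 (z + r - rd d))
    <= alpha * E t (fun d => f false t.+1 (z + th - rd d)).
  apply: (alphaE_diff_le ok) => // [|||d d0];
    [exact: (integ_V ok)|exact: (integ_V ok)|exact: (integ_Phi ok)|].
  rewrite (addrAC z r) (addrAC z th); apply: IH => //; exact: gridB (rd_grid th d).
have := C_lip ok z (z + r) t0T; have -> : z - (z + r) = - r by ring.
rewrite normrN; case/andP: rth => r0 rth; rewrite (ger0_norm r0).
have : gamma t * r <= gamma t * th by rewrite ler_wpM2l ?(gamma_ge0 ok)// ltW.
by move=> h1 /(le_trans (ler_norm _)); lra.
Qed.

Lemma V_down t : (t < T)%N -> V_down_at t.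
Proof.
have th0' := th0.
move: t; apply: downward_ind => [|z r _ /andP[r0 rth]|t tT IH z r gz rth].
- by have := gm_T ok; lia.
- rewrite -[leRHS]mul1r; apply: le_trans (ler_norm _) _.
  by apply: (V_last_lip ok (n := 1)); lra.
have t0T := step_lt tT; have gs := grid_s ok tT; have gz1 := gridDth gz.
have [zs|sz] := ltP z (s t).
  rewrite !V_ltE// ?subrr ?(Phi_ge0 ok)//.
  by have := grid_lt_le th0 gz gs zs; case/andP: rth; lra.
rewrite (Phi_gt ok)//; last by lra.
rewrite !V_geE//; first exact: H_down_of.
by case/andP: rth; lra.
Qed.

Lemma H_down t (z r : R) : (t.+1 < T)%N -> grid z -> 0 <= r < th ->
  H t z - H t (z + r) <= p false t (z + th).
Proof. by move=> tT; apply: H_down_of => //; exact: V_down. Qed.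

Lemma C_incr_mono t (z z' q : R) : (t < T)%N -> 0 <= q -> z + q <= z' ->
  C t (z + q) - C t z <= C t (z' + q) - C t z'.
Proof.
move=> tT; rewrite le_eqVlt => /predU1P[<-|q0] zz; first by rewrite !addr0 !subrr.
have h1 : z < z + q by lra.
have h2 : z + q <= z' + q by lra.
have h3 : z' < z' + q by lra.
have := C_convex3 ok tT h1 h2.
have h4 : (z' - (z + q)) * (C t (z' + q) - C t z') >= q * (C t z' - C t (z + q)).
  move: zz; rewrite le_eqVlt => /predU1P[->|zz]; first by rewrite !subrr mulr0 mul0r.
  have := C_convex3 ok tT zz (ltW h3).
  by have -> : z' + q - z' = q by ring.
have -> : z' + q - (z + q) = z' - z by ring.
have -> : z + q - z = q by ring.
move=> h5; have D0 : 0 < z' - z by lra.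
rewrite -(ler_pM2l D0); lra.
Qed.

(* Increments of a convex function are nondecreasing, so only the difference of the
   lengths q and q' costs anything; this replaces the K-convexity of H off the grid. *)
Definition V_incr_at t : Prop := forall z z' q q' : R, grid z -> grid z' -> z < z' ->
  0 <= q < th -> 0 <= q' < th ->
  (V t (z + q) - V t z) - (V t (z' + q') - V t z') <= f false t (z' + th).

Lemma C_incr_diff t (z z' q q' : R) : (t < T)%N -> z + q <= z' ->
  0 <= q < th -> 0 <= q' < th ->
  (C t (z + q) - C t z) - (C t (z' + q') - C t z') <= gamma t * th.
Proof.
move=> tT zz /andP[q0 qt] /andP[q0' qt'].
have := C_incr_mono tT q0 zz; have := C_lip ok (z' + q) (z' + q') tT.
have -> : z' + q - (z' + q') = q - q' by ring.
have : gamma t * `|q - q'| <= gamma t * th.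
  by rewrite ler_wpM2l ?(gamma_ge0 ok)// ler_norml; apply/andP; split; lra.
by move=> h1 /(le_trans (ler_norm _)); lra.
Qed.

Lemma H_incr_of t (z z' q q' : R) : (t.+1 < T)%N -> V_incr_at t.+1 ->
  grid z -> grid z' -> z < z' -> 0 <= q < th -> 0 <= q' < th ->
  (H t (z + q) - H t z) - (H t (z' + q') - H t z') <= p false t (z' + th).
Proof.
move=> tT IH gz gz' zz' qt qt'; have t0T := step_lt tT.
rewrite !(Hf_step ok)// (Psi_step ok)//.
have iV y := integ_V ok t.+1 y t0T.
have h : alpha * E t (fun d => V t.+1 (z + q - rd d) - V t.+1 (z - rd d)) -
    alpha * E t (fun d => V t.+1 (z' + q' - rd d) - V t.+1 (z' - rd d))
    <= alpha * E t (fun d => f false t.+1 (z' + th - rd d)).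
  apply: (alphaE_diff_le ok) => // [|||d d0];
    [exact: integB|exact: integB|exact: (integ_Phi ok)|].
  rewrite (addrAC z q) (addrAC z' q') (addrAC z' th); have gd := rd_grid th d.
  by apply: IH; rewrite ?ltrD2r//; exact: gridB.
rewrite !expectB// in h.
have zq : z + q <= z' by have := grid_lt_le th0 gz gz' zz'; case/andP: qt; lra.
by have := C_incr_diff t0T zq qt qt'; lra.
Qed.

Lemma V_incr t : (t < T)%N -> V_incr_at t.
Proof.
have th0' := th0.
move: t; apply: downward_ind => [|z z' q q' gz gz' zz' qt qt'|t tT IH z z' q q' gz gz' zz' qt qt'].
- by have := gm_T ok; lia.
- have lT := last_lt ok; rewrite !(V_last ok) Phi_last.
  have zq := grid_lt_le th0 gz gz' zz'.
  case/andP: (qt) => q0 qth; case/andP: (qt') => q0' qth'.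
  have dec : C T.-1 (Num.max z' (s T.-1)) - C T.-1 (Num.max (z' + q') (s T.-1)) <= gamma T.-1 * th.
    apply: le_trans (ler_norm _) (le_trans (C_lip ok _ _ lT) _).
    rewrite ler_wpM2l ?(gamma_ge0 ok)// ler_norml /Num.max.
    by case: ltP => ?; case: ltP => ?; apply/andP; split; lra.
  case: ifPn => [zs|_].
    by rewrite !max_r ?subrr//; lra.
  have [sz|] := boolP (s T.-1 <= z).
    rewrite !max_l; [|lra..].
    by apply: C_incr_diff => //; lra.
  rewrite -ltNge => zs; have [zqs|] := boolP (z + q <= s T.-1).
    by rewrite max_r// max_r ?(ltW zs)//; move: dec; lra.
  rewrite -ltNge => szq; rewrite max_l ?(ltW szq)// (max_r (ltW zs)) (max_l (x := z' + q')) ?(max_l (x := z')); [|lra..].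
  (* The last s need not be a grid point and may fall inside the cell; the increment then
     effectively starts at s. *)
  have := @C_incr_diff T.-1 (s T.-1) z' (z + q - s T.-1) q' lT.
  have -> : s T.-1 + (z + q - s T.-1) = z + q by ring.
  by apply => //; [lra|apply/andP; split; lra].
have t0T := step_lt tT; have gs := grid_s ok tT; have gz1 := gridDth gz'.
case/andP: (qt) => q0 qth; case/andP: (qt') => q0' qth'.
have lt_cell (x r : R) : grid x -> 0 <= r < th -> x < s t -> x + r < s t.
  by move=> gx /andP[_ rt] xs; have := grid_lt_le th0 gx gs xs; lra.
have [zs'|sz'] := ltP z' (s t).
  have zs := lt_trans zz' zs'.
  rewrite (V_ltE zs) (V_ltE zs') (V_ltE (lt_cell _ _ gz qt zs)).
  by rewrite (V_ltE (lt_cell _ _ gz' qt' zs')) !subrr (Phi_ge0 ok).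
rewrite (Phi_gt ok)//; last by lra.
rewrite (V_geE sz') (V_geE (y := z' + q')); last by lra.
have [zs|sz] := ltP z (s t); last by rewrite !V_geE//; [exact: H_incr_of|lra].
(* The left increment vanishes; what remains is a downward increment within one half-open cell. *)
rewrite (V_ltE zs) (V_ltE (lt_cell _ _ gz qt zs)).
by have := H_down tT gz' qt'; lra.
Qed.

Lemma H_incr t (z z' q q' : R) : (t.+1 < T)%N -> grid z -> grid z' -> z < z' ->
  0 <= q < th -> 0 <= q' < th ->
  (H t (z + q) - H t z) - (H t (z' + q') - H t z') <= p false t (z' + th).
Proof. by move=> tT; apply: H_incr_of => //; exact: V_incr. Qed.

End Increments.

(** * Comparison of the grid value with the optimal value *)

Section OptimalValue.
Variables (R : realType) (M : invModel R) (sT1 : R) (gamma : nat -> R) (th : R).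
Hypothesis ok : grid_model M sT1 gamma th.
Local Notation T := (horizon M).
Local Notation alpha := (disc M).
Local Notation K := (setup M).
Local Notation C := (Cfun M).
Local Notation m := (Cmin M).
Local Notation SU := (SU M th).
Local Notation H := (Hf M th sT1).
Local Notation S := (Sg M th sT1).
Local Notation s := (sg M th sT1).
Local Notation V := (Vfun M th sT1).
Local Notation grid := (onGrid th).
Local Notation E := (expect M).
Local Notation rd := (rd th).

Let th0 := gm_th ok.

Local Notation p b t := (Psi M sT1 gamma th b t th).
Local Notation f b t := (Phi M sT1 gamma th b t th).

Local Notation c := (cost M).
Local Notation G := (Gf M).

Lemma integ_affine t (k y : R) : (t < T)%N -> integ M t (fun d => k * (y - d)).
Proof.
move=> tT; apply: integZ; apply: integB; [exact: integ_cst|exact: (gm_mean ok)].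
Qed.

(* Adding c_t x to the cost-to-go turns the one-period cost into C_t. *)
Lemma cost_shift t (v : R -> R) (x y : R) : (t < T)%N -> integ M t (fun d => v (y - d)) ->
  c t * (y - x) + G t y + alpha * E t (fun d => v (y - d)) =
  - (c t * x) + (C t y + alpha * E t (fun d => v (y - d) + c t.+1 * (y - d))).
Proof.
move=> tT iv; have im := gm_mean ok tT; have ic := integ_cst M t y.
rewrite expectD//; last exact: integ_affine.
rewrite expectZ; last exact: integB.
rewrite expectB// expect_cst /Cfun /mean_demand.
ring.
Qed.

Definition Vs t (x : R) : R := vopt M t x + c t * x.
Definition Hs t (y : R) : R := C t y + alpha * E t (fun d => Vs t.+1 (y - d)).

Lemma integ_Vs t (y : R) : (t < T)%N -> integ M t (fun d => Vs t.+1 (y - d)).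
Proof.
by move=> tT; apply: integD; [exact: (gm_vopt ok)|exact: integ_affine].
Qed.

Lemma Vs_T (x : R) : Vs T x = 0.
Proof. by rewrite /Vs /vopt subnn /= mulNr addNr. Qed.

Lemma vopt_step t (x : R) : (t < T)%N ->
  vopt M t x = inf [set - (c t * x) + (K t * delta (y - x) + Hs t y) | y in [set y | x <= y]].
Proof.
move=> tT; rewrite {1}/vopt.
have -> : (T - t = (T - t.+1).+1)%N by lia.
rewrite /=; have -> : (T - (T - t.+1).+1 = t)%N by lia.
congr inf; apply: eq_imagel => y _.
have := cost_shift x tT (gm_vopt ok tT y); rewrite -/(Hs t y) /vopt => h.
by rewrite -[RHS]addrCA -h; ring.
Qed.

Lemma delta_ge0 (z : R) : 0 <= delta z.
Proof. by rewrite /delta; case: ifP. Qed.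

Lemma delta_le1 (z : R) : delta z <= 1.
Proof. by rewrite /delta; case: ifP. Qed.

Lemma Vs_ge t (x b : R) : (t < T)%N ->
  (forall y : R, x <= y -> b <= K t * delta (y - x) + Hs t y) -> b <= Vs t x.
Proof.
move=> tT bP; rewrite /Vs vopt_step// -lerBlDr; apply: lb_le_inf.
  by exists (- (c t * x) + (K t * delta (x - x) + Hs t x)), x => /=.
by move=> _ [y /= xy <-]; have := bP y xy; lra.
Qed.

(** The real-valued [inf] is a lower bound only of sets bounded below. Each stage costs at least the
    minimum of C_t, which supplies this for [Vs_le]. *)
Lemma Vs_bounded t : (t <= T)%N -> exists L : R, forall x : R, L <= Vs t x.
Proof.
rewrite -ltnS; move: t; apply: downward_ind => [//||t tT [L LP]].
  by exists 0 => x; rewrite /= Vs_T.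
rewrite ltnS in tT.
exists (C t (m t) + alpha * L) => x; apply: Vs_ge => // y _.
have h1 := C_min ok y tT.
have h2 : L <= E t (fun d => Vs t.+1 (y - d)).
  by apply: (expect_ge_cst (gm_P0 ok tT)) => //; exact: integ_Vs.
have := ler_wpM2l (alpha_ge0 ok) h2.
have := mulr_ge0 (gm_setup0 ok tT) (delta_ge0 (y - x)).
by rewrite /Hs; lra.
Qed.

Lemma Vs_le t (x y : R) : (t < T)%N -> x <= y -> Vs t x <= K t * delta (y - x) + Hs t y.
Proof.
move=> tT xy; rewrite /Vs vopt_step//.
have : inf [set - (c t * x) + (K t * delta (y0 - x) + Hs t y0) | y0 in [set y0 | x <= y0]]
    <= - (c t * x) + (K t * delta (y - x) + Hs t y).
  apply: ge_inf; last by exists y.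
  have [L LP] := Vs_bounded tT.
  exists (- (c t * x) + (C t (m t) + alpha * L)) => _ [y0 _ <-].
  have h1 := C_min ok y0 tT.
  have h2 : L <= E t (fun d => Vs t.+1 (y0 - d)).
    by apply: (expect_ge_cst (gm_P0 ok tT)) => //; exact: integ_Vs.
  have := ler_wpM2l (alpha_ge0 ok) h2.
  have := mulr_ge0 (gm_setup0 ok tT) (delta_ge0 (y0 - x)).
  by rewrite /Hs; lra.
by lra.
Qed.

Lemma Vs_le_Hs t (x : R) : (t < T)%N -> Vs t x <= Hs t x.
Proof. by move=> tT; have := Vs_le tT (lexx x); rewrite subrr /delta ltxx mulr0 add0r. Qed.

Lemma Vs_le_KHs t (x y : R) : (t < T)%N -> x <= y -> Vs t x <= K t + Hs t y.
Proof.
move=> tT xy; apply: le_trans (Vs_le tT xy) _; rewrite lerD2r.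
by rewrite -[leRHS]mulr1 ler_wpM2l ?delta_le1// (gm_setup0 ok).
Qed.

Lemma Vs_leK t (x y : R) : (t < T)%N -> x <= y -> Vs t x <= Vs t y + K t.
Proof.
move=> tT xy; rewrite -lerBlDr; apply: Vs_ge => // y' yy'.
have := Vs_le_KHs tT (le_trans xy yy').
by have := mulr_ge0 (gm_setup0 ok tT) (delta_ge0 (y' - y)); lra.
Qed.

Lemma EVs_leK t (x y : R) : (t.+1 < T)%N -> x <= y ->
  alpha * E t (fun d => Vs t.+1 (x - d)) <= alpha * E t (fun d => Vs t.+1 (y - d)) + K t.
Proof.
move=> tT xy; have t0T := step_lt tT.
have ic := integ_cst M t (K t.+1).
have : alpha * E t (fun d => Vs t.+1 (x - d)) - alpha * E t (fun d => Vs t.+1 (y - d))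
    <= alpha * E t (fun=> K t.+1).
  apply: (alphaE_diff_le ok) => //; [exact: integ_Vs|exact: integ_Vs|].
  move=> d _; have xyd : x - d <= y - d by rewrite lerD2r.
  by have := Vs_leK tT xyd; lra.
by rewrite expect_cst; have := gm_setup ok tT; lra.
Qed.

Lemma Hs_last (y : R) : Hs T.-1 y = C T.-1 y.
Proof.
rewrite /Hs; have -> : T.-1.+1 = T by have := gm_T ok; lia.
have -> : (fun d => Vs T (y - d)) = (fun=> 0) by apply/funext => d; rewrite Vs_T.
by rewrite expect_cst mulr0 addr0.
Qed.

Lemma Vs_last (x : R) : Vs T.-1 x = V T.-1 x.
Proof.
have lT := last_lt ok; have K0 := gm_setup0 ok lT.
have sl : s T.-1 = sT1 by rewrite /sg gst_last.
have sm : s T.-1 <= m T.-1 by rewrite sl (gm_sT1_le ok).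
have Cs : C T.-1 (s T.-1) = C T.-1 (m T.-1) + K T.-1 by rewrite sl (gm_sT1 ok).
rewrite (V_last ok); apply/le_anti/andP; split.
  have [xs|sx] := leP x (s T.-1); last by have := Vs_le_Hs x lT; rewrite Hs_last.
  by have := Vs_le_KHs lT (le_trans xs sm); rewrite Hs_last Cs; lra.
apply: Vs_ge => // y; rewrite Hs_last le_eqVlt => /predU1P[<-|xy].
  rewrite subrr /delta ltxx mulr0 add0r.
  have [xs|sx //] := leP x (s T.-1).
  by move: xs; rewrite le_eqVlt => /predU1P[->//|xs]; rewrite ltW// (C_decr ok).
rewrite /delta subr_gt0 xy mulr1.
have Cy := C_min ok y lT.
have [xs|sx] := leP x (s T.-1); first by rewrite Cs; lra.
have [xm|mx] := leP x (m T.-1); last by have := C_incr ok lT (ltW mx) (ltW xy); lra.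
by have := C_decr ok lT sx xm; lra.
Qed.

Local Notation omb := (omegabar M th sT1 gamma).

Definition om t (z : R) : R := p false t z - gamma t * th + alpha * E t (fun d => omb t.+1 (z - rd d)).
Definition eta t : R := p true t (SU t) + om t (SU t).

Lemma omegabar_last (z : R) : omb T.-1 z = 0.
Proof. by rewrite /omegabar subnn. Qed.

Lemma omegabar_evcst t : (t < T)%N -> evcst (omb t).
Proof.
move=> /ltn_last_or[->|tT]; first by exists 0, 0 => z _; exact: omegabar_last.
rewrite /omegabar gst_rank//= stage_index//.
by exists (SU t); eexists => z zS; rewrite (ltW zS); reflexivity.
Qed.

Lemma integ_omegabar t u (y : R) : (t < T)%N -> (u < T)%N -> integ M t (fun d => omb u (y - rd d)).
Proof. by move=> tT uT; exact: (integ_rd (gm_P0 ok tT) th0 y (omegabar_evcst uT)). Qed.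

Lemma omegabar_step t (z : R) : (t.+1 < T)%N ->
  omb t z = if z <= SU t then eta t else Num.max (eta t) (om t z).
Proof.
move=> tT; have e y : om t y = psi M th sT1 gamma t th y - gamma t * th +
    alpha * gsum (fun n => omb t.+1 (y - zg th n) * fmass M th t n).
  by rewrite (gsum_expect (gm_P0 ok (step_lt tT)) th0 _ (omegabar_evcst tT)).
by rewrite /eta !e /omegabar gst_rank//= stage_index.
Qed.

(** Subtracting gamma_t th removes the share of C_t from psi. What is left is the rounding error of
    V_{t+1}, one phi, plus the error inherited from stage t + 1. *)
Lemma om_expect t (z : R) : (t.+1 < T)%N ->
  om t z = alpha * E t (fun d => f false t.+1 (z - rd d) + omb t.+1 (z - rd d)).
Proof.
move=> tT; have t0T := step_lt tT; rewrite /om (Psi_step ok)// expectD; first by ring.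
- exact: (integ_Phi ok).
- exact: integ_omegabar.
Qed.

Lemma om_mono_of t (z z' : R) : (t.+1 < T)%N ->
  (forall z z' : R, grid z -> grid z' -> z <= z' -> omb t.+1 z <= omb t.+1 z') ->
  grid z -> grid z' -> z <= z' -> om t z <= om t z'.
Proof.
move=> tT IH gz gz' zz'; have t0T := step_lt tT.
rewrite /om; have := Psi_mono ok false tT gz gz' zz'.
have : alpha * E t (fun d => omb t.+1 (z - rd d)) <= alpha * E t (fun d => omb t.+1 (z' - rd d)).
  rewrite ler_wpM2l ?(alpha_ge0 ok)//.
  apply: (expect_le (gm_P0 ok t0T)); [exact: integ_omegabar|exact: integ_omegabar|].
  by move=> d _; have gd := rd_grid th d; apply: IH; rewrite ?lerD2r//; exact: gridB.
by lra.
Qed.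

Lemma omegabar_mono t : (t < T)%N ->
  forall z z' : R, grid z -> grid z' -> z <= z' -> omb t z <= omb t z'.
Proof.
move: t; apply: downward_ind => [|z z' _ _ _|t tT IH z z' gz gz' zz'].
- by have := gm_T ok; lia.
- by rewrite !omegabar_last.
rewrite !omegabar_step//; case: (leP z' (SU t)) => z'S; first by rewrite (le_trans zz').
have := om_mono_of tT IH gz gz' zz'; case: ifP => _; first by rewrite le_max lexx.
by move=> h; rewrite ge_max !le_max lexx h orbT.
Qed.

Lemma om_mono t (z z' : R) : (t.+1 < T)%N -> grid z -> grid z' -> z <= z' -> om t z <= om t z'.
Proof. by move=> tT; apply: om_mono_of => //; exact: omegabar_mono. Qed.

Lemma om_le_omegabar t (z : R) : (t.+1 < T)%N -> grid z -> om t z <= omb t z.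
Proof.
move=> tT gz; have [gS _ _] := SU_spec ok (step_lt tT); rewrite omegabar_step//.
case: ifP => [zS|_]; last by rewrite le_max lexx orbT.
by have := om_mono tT gz gS zS; have := Psi_ge0 ok true tT gS; rewrite /eta; lra.
Qed.

Lemma gceil_cell (x : R) : [/\ grid (gceil th x), gceil th x - th < x & x <= gceil th x].
Proof.
have := gceil_lt th0 x; have := le_gceil th0 x; split=> //; last lra.
exact: gceil_grid.
Qed.

(* Only upward increments of V enter this bound, which is why psi rather than its barred
   version occurs in omega. *)
Definition V_lower_at t : Prop := forall z x : R, grid z -> z - th < x <= z ->
  V t x - Vs t x <= omb t z.

Lemma H_lower_of t (z y : R) : (t.+1 < T)%N -> V_lower_at t.+1 -> grid z ->
  z - th < y <= z -> H t y - Hs t y <= om t z.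
Proof.
move=> tT IH gz /andP[zy yz]; have t0T := step_lt tT.
rewrite om_expect// (Hf_step ok)// /Hs.
have iS := integ_Vs y t0T; have iV := integ_V ok t.+1 y t0T.
suff : alpha * E t (fun d => V t.+1 (y - rd d)) - alpha * E t (fun d => Vs t.+1 (y - d)) <=
  alpha * E t (fun d => f false t.+1 (z - rd d) + omb t.+1 (z - rd d)) by lra.
apply: (alphaE_diff_le ok) => //.
  by apply: integD; [exact: (integ_Phi ok)|exact: integ_omegabar].
move=> d d0; have [d1 d2 d3] := rdP th0 d0; have gzd := gridB gz (rd_grid th d).
have h1 : V t.+1 (y - rd d) - V t.+1 (y - d) <= f false t.+1 (z - rd d).
  by apply: (V_up ok) => //; apply/andP; split; lra.
have [gc c1 c2] := gceil_cell (y - d).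
have h2 : V t.+1 (y - d) - Vs t.+1 (y - d) <= omb t.+1 (gceil th (y - d)).
  by apply: IH => //; rewrite c1.
have h3 : omb t.+1 (gceil th (y - d)) <= omb t.+1 (z - rd d).
  by apply: omegabar_mono => //; apply: gceil_le => //; lra.
by lra.
Qed.

(** The off-grid substitute for [kconvex_reorder]. That lemma is applied at the left ends a and b of
    the cells of x and y, and the offsets x - a and y - b together cost at most one modulus. *)
Lemma H_reorder t (x y : R) : (t.+1 < T)%N -> s t <= x -> x < y -> y <= SU t ->
  H t x <= K t + H t y + p true t (SU t).
Proof.
move=> tT sx xy yS; have t0T := step_lt tT; have gs := grid_s ok tT.
have [gS mS _] := SU_spec ok t0T; have K0 := gm_setup0 ok t0T; have th0' := th0.
have sp := stage_specP ok t0T.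
have floorP (v : R) : exists2 a : R, grid a & a <= v < a + th.
  exists (zg th (Num.floor (v / th))); first exact: grid_zg.
  rewrite zgS /zg -ler_pdivlMr// -ltr_pdivrMr// floor_le; exact: floorD1_gt.
have [a ga /andP[ax xa]] := floorP x; have [b gb /andP[yb yb']] := floorP y.
have sa : s t <= a by apply: (grid_le_of_lt th0 gs ga); lra.
have ab : a <= b by apply: (grid_le_of_lt th0 ga gb); lra.
have pS := Psi_mono ok _ tT _ gS.
have [ab'|ab'] := eqVneq a b.
  have aS : a + th <= SU t by apply: (grid_lt_le th0 ga gS); lra.
  have := @H_modulus _ _ _ _ _ ok t 0 (a + th) x y tT (gridDth ga).
  rewrite mul0r add0r mul1r => h.
  have {}h : `|H t x - H t y| <= p true t (a + th) by apply: h; lra.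
  have := pS true _ (gridDth ga) aS; move: h; rewrite ler_norml => /andP[_]; lra.
have {}ab : a < b by rewrite lt_neqAle ab'.
have Hab : H t a <= K t + H t b.
  apply: (kconvex_reorder K0 (sp_kconvex sp) (sp_live_S sp) (sp_live_s sp) (sp_sS sp) (sp_HsS sp)
    (sp_minS sp)) => //; last exact: ltW.
have pS' z : grid z -> z <= SU t -> p false t z <= p true t (SU t).
  by move=> gz zS; apply: le_trans (Psi_falseW ok tT gz) (pS true _ gz zS).
(* For y = b, [H_incr] would evaluate psi at b + th, possibly beyond S^U_t. The increment from a to
   x is bounded by psi at a + th <= b instead. *)
have [yb0|yb0] := eqVneq y b.
  have ab2 := grid_lt_le th0 ga gb ab.
  have : H t x - H t a <= p true t (SU t).
    have [->|xa0] := eqVneq x a; first by rewrite subrr (Psi_ge0 ok).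
    apply: le_trans (pS' (a + th) (gridDth ga) _); last by rewrite -yb0 in ab2; lra.
    have ax' : a < x by rewrite lt_neqAle eq_sym xa0.
    by apply: (H_up ok) => //; [exact: gridDth|apply/andP; split; lra|apply/andP; split; lra].
  by rewrite yb0; lra.
have {}yb0 : b < y by rewrite lt_neqAle eq_sym yb0.
have bS : b + th <= SU t by apply: (grid_lt_le th0 gb gS); lra.
have qx : 0 <= x - a < th by apply/andP; split; lra.
have qy : 0 <= y - b < th by apply/andP; split; lra.
have := H_incr ok tT ga gb ab qx qy.
have -> : a + (x - a) = x by ring.
have -> : b + (y - b) = y by ring.
by have := pS' (b + th) (gridDth gb) bS; lra.
Qed.

Lemma V_lower_step t : (t.+1 < T)%N -> V_lower_at t.+1 -> V_lower_at t.
Proof.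
move=> tT IH z x gz zx; have t0T := step_lt tT; have gs := grid_s ok tT.
have sp := stage_specP ok t0T; have [gSU mS CS] := SU_spec ok t0T.
have [gS _ SS _] := Sg_spec ok tT.
have K0 := gm_setup0 ok t0T; have th0' := th0; have sS := sp_sS sp.
have [gz0 z0m mz0] := zn0_spec ok t; have z0S := zn0_lt_SU ok t0T.
set z0 := gmaxlt th (m t) in gz0 z0m mz0 z0S CS.
have HHs (y : R) : H t y - om t (gceil th y) <= Hs t y.
  have [gc c1 c2] := gceil_cell y.
  have : H t y - Hs t y <= om t (gceil th y) by apply: H_lower_of => //; rewrite c1.
  by lra.
have HHS (y : R) : y <= SU t -> H t y - om t (SU t) <= Hs t y.
  move=> yS; have := HHs y; have [gc _ _] := gceil_cell y.
  by have := om_mono tT gc gSU (gceil_le th0 gSU yS); lra.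
have pS z' : grid z' -> z' <= SU t -> p true t z' <= p true t (SU t).
  by move=> gz' zS; exact: (Psi_mono ok).
have etaE : eta t = p true t (SU t) + om t (SU t) by [].
(* C_t gains more than K_t between z_{n_0} and y, while [EVs_leK] lets the future cost fall by at
   most K_t. *)
have Hz0 (y : R) : SU t < y -> Hs t z0 <= Hs t y.
  move=> Sy; have := EVs_leK tT (ltW (lt_trans z0S Sy)).
  by have := C_incr ok t0T mS (ltW Sy); rewrite /Hs; lra.
have HSmin (y : R) : H t (S t) - eta t <= Hs t y.
  have low y' : y' <= SU t -> H t (S t) - eta t <= Hs t y'.
    move=> yS; have := HHS _ yS; have [gc c1 c2] := gceil_cell y'.
    have cS := gceil_le th0 gSU yS.
    have := sp_minS sp (grid_live (t := t) gc).
    have := @H_modulus _ _ _ _ _ ok t 0 (gceil th y') y' (gceil th y') tT gc.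
    rewrite mul0r add0r mul1r => h.
    have {}h : `|H t y' - H t (gceil th y')| <= p true t (gceil th y') by apply: h; lra.
    by have := pS _ gc cS; move: h; rewrite ler_norml => /andP[]; lra.
  have [yS|Sy] := leP y (SU t); first exact: low.
  by apply: le_trans (Hz0 y Sy); apply: low; exact: ltW.
have zSU : x <= SU t -> omb t z = eta t.
  move=> xS; rewrite omegabar_step// (_ : z <= SU t)//.
  by case/andP: zx => zx _; apply: (grid_le_of_lt th0 gz gSU); lra.
case/andP: (zx) => zx1 zx2.
rewrite lerBlDr -lerBlDl; apply: Vs_ge => // y; rewrite le_eqVlt => /predU1P[<-|xy].
  rewrite subrr /delta ltxx mulr0 add0r.
  have Hx := H_lower_of tT IH gz zx; have omz := om_le_omegabar tT gz.
  have [xs|sx] := ltP x (s t); last by rewrite V_geE//; lra.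
  have zs : z <= s t by apply: (grid_le_of_lt th0 gz gs); lra.
  have zS : z <= SU t by lra.
  rewrite V_ltE// zSU; last lra.
  (* Not ordering at x < s_t saves little: ordering is at least as good at the grid point z - th <
     s_t, and x is within one cell of it. *)
  have := sp_below sp (grid_live (t := t) (gridBth gz)).
  have zs' : z - th < s t by lra.
  move=> /(_ zs') low.
  have := @H_modulus _ _ _ _ _ ok t 0 z (z - th) x tT gz.
  rewrite mul0r add0r mul1r => h.
  have {}h : `|H t (z - th) - H t x| <= p true t z by apply: h; lra.
  have := pS _ gz zS; have := om_mono tT gz gSU zS.
  by move: h; rewrite ler_norml => /andP[_]; lra.
rewrite /delta subr_gt0 xy mulr1.
have [xs|sx] := ltP x (s t).
  by rewrite V_ltE// zSU; [have := HSmin y; lra|lra].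
rewrite V_geE//.
have mid (y' : R) : x < y' -> y' <= SU t -> H t x - omb t z <= K t + Hs t y'.
  move=> xy' yS; rewrite zSU; last lra.
  by have := H_reorder tT sx xy' yS; have := HHS _ yS; lra.
have [yS|Sy] := leP y (SU t); first exact: mid.
have [xz0|z0x] := ltP x z0.
  by apply: le_trans (mid z0 xz0 (ltW z0S)) _; rewrite lerD2l Hz0.
have Hx := H_lower_of tT IH gz zx; have omz := om_le_omegabar tT gz.
(* With z_{n_0} <= x and y beyond S^U_t, staying at x is at least as good as ordering up to y. *)
have := EVs_leK tT (ltW xy); have := C_le_of_SU ok t0T z0x (ltW xy) (ltW Sy).
by move: Hx; rewrite /Hs; lra.
Qed.

Lemma V_lower t : (t < T)%N -> V_lower_at t.
Proof.
apply: downward_ind => [|z x gz _|]; last exact: V_lower_step.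
  by have := gm_T ok; lia.
by rewrite Vs_last subrr omegabar_last.
Qed.

(* The recursion shifts w by D and u by the rounded demand, so the distance between the two
   points grows by one cell per stage; the induction needs all distances i * th. *)
Definition V_upper_at t : Prop := forall (i : nat) (z w u : R), grid z ->
  z - th < u <= z -> u - i%:R * th <= w <= u -> Vs t w - V t u <= i%:R * f false t z + omb t z.

Lemma H_upper_of t (i : nat) (z w u : R) : (t.+1 < T)%N -> V_upper_at t.+1 -> grid z ->
  z - th < u <= z -> u - i%:R * th <= w <= u ->
  Hs t w - H t u <= C t w - C t u +
    (i%:R * (p false t z - gamma t * th) + om t z).
Proof.
move=> tT IH gz /andP[zu uz] /andP[uw wu]; have t0T := step_lt tT.
have iF := integ_Phi ok false th z t0T tT; have iO := integ_omegabar z t0T tT.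
(* Of the i + 1 copies of phi, one is the rounding error already contained in omega_t. *)
have -> : i%:R * (p false t z - gamma t * th) + om t z =
  alpha * E t (fun d => i.+1%:R * f false t.+1 (z - rd d) + omb t.+1 (z - rd d)).
  rewrite expectD//; last exact: integZ.
  by rewrite expectZ// om_expect// expectD// (Psi_step ok)// -natr1; ring.
rewrite /Hs (Hf_step ok)//.
suff : alpha * E t (fun d => Vs t.+1 (w - d)) - alpha * E t (fun d => V t.+1 (u - rd d)) <=
  alpha * E t (fun d => i.+1%:R * f false t.+1 (z - rd d) + omb t.+1 (z - rd d)) by lra.
apply: (alphaE_diff_le ok) => //; [exact: integ_Vs|exact: (integ_V ok)| |].
  by apply: integD => //; exact: integZ.
move=> d d0; have [d1 d2 d3] := rdP th0 d0.
apply: IH; [exact: gridB gz (rd_grid th d)|apply/andP; split; lra|].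
by rewrite -natr1; apply/andP; split; lra.
Qed.

Lemma V_upper t : (t < T)%N -> V_upper_at t.
Proof.
have th0' := th0.
apply: downward_ind => [|i z w u gz /andP[zu uz] /andP[uw wu]|{}t tT IH i z w u gz zu uw].
- by have := gm_T ok; lia.
- rewrite Vs_last omegabar_last addr0; apply: le_trans (ler_norm _) _.
  by apply: (V_last_lip ok) => //; lra.
have t0T := step_lt tT; have sp := stage_specP ok t0T.
have [gSU mS CS] := SU_spec ok t0T; have sS := sp_sS sp.
have [gS _ SS _] := Sg_spec ok tT.
have HsH (y z' : R) : grid z' -> z' - th < y <= z' -> Hs t y - H t y <= om t z'.
  move=> gz' yz; have := @H_upper_of t 0 z' y y tT IH gz' yz.
  by rewrite !mul0r subr0 subrr !add0r lexx; apply.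
case/andP: (zu) => zu1 zu2; case/andP: (uw) => uw1 uw2.
(* Up to S^U_t the barred term of [V_modulus] is absorbed by eta_t. Beyond S^U_t >= s_t, u lies
   where V = H, so the Lipschitz bound on C_t suffices. *)
have [zS|Sz] := leP z (SU t).
  have h1 : Vs t w <= V t w + om t (SU t).
    have [ws|sw] := ltP w (s t).
      rewrite V_ltE//; have wS : w <= S t by lra.
      have := Vs_le_KHs t0T wS; have := om_mono tT gS gSU SS.
      have S1 : S t - th < S t <= S t by apply/andP; split; lra.
      by have := HsH (S t) (S t) gS S1; lra.
    rewrite V_geE//; have [gc c1 c2] := gceil_cell w.
    have c3 : gceil th w <= SU t by apply: gceil_le => //; lra.
    have cc : gceil th w - th < w <= gceil th w by rewrite c1.
    by have := HsH _ _ gc cc; have := Vs_le_Hs w t0T; have := om_mono tT gc gSU c3; lra.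
  have h2 : `|V t w - V t u| <= i%:R * f false t z + f true t z.
    by apply: (V_modulus ok) => //; rewrite -?natr1; lra.
  have h3 := Phi_le_Psi ok true tT gz; have h4 := Psi_mono ok true tT gz gSU zS.
  by rewrite omegabar_step// zS /eta; move: h2; rewrite ler_norml => /andP[_]; lra.
have Su : SU t < u by have := grid_lt_le th0 gSU gz Sz; lra.
rewrite V_geE; last by lra.
have h1 := H_upper_of tT IH gz zu uw.
have h2 : C t w - C t u <= i%:R * (gamma t * th).
  apply: le_trans (ler_norm _) (le_trans (C_lip ok _ _ t0T) _).
  rewrite mulrCA ler_wpM2l ?(gamma_ge0 ok)// distrC ger0_norm ?subr_ge0//; lra.
have h3 := om_le_omegabar tT gz; have h4 := Vs_le_Hs w t0T.
by rewrite (Phi_gt ok)//; lra.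
Qed.

Lemma optimal_error t (z x : R) : (t < T)%N -> grid z -> z - th < x <= z ->
  `|V t x - Vs t x| <= omb t z.
Proof.
move=> tT gz zx; have := V_lower tT gz zx; have := @V_upper t tT 0 z x x gz zx.
rewrite !mul0r subr0 lexx add0r => /(_ isT) h1 h2.
by rewrite ler_norml; apply/andP; split; lra.
Qed.

End OptimalValue.

(** * Comparison of the policy cost with the grid value *)

Section PolicyValue.
Variables (R : realType) (M : invModel R) (sT1 : R) (gamma : nat -> R) (th : R).
Hypothesis ok : grid_model M sT1 gamma th.
Local Notation T := (horizon M).
Local Notation alpha := (disc M).
Local Notation K := (setup M).
Local Notation C := (Cfun M).
Local Notation H := (Hf M th sT1).
Local Notation S := (Sg M th sT1).
Local Notation s := (sg M th sT1).
Local Notation V := (Vfun M th sT1).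
Local Notation grid := (onGrid th).
Local Notation E := (expect M).
Local Notation rd := (rd th).

Let th0 := gm_th ok.

Local Notation p b t := (Psi M sT1 gamma th b t th).
Local Notation f b t := (Phi M sT1 gamma th b t th).

Local Notation c := (cost M).
Local Notation epsb := (epsbar M th sT1 gamma).

Definition Vp t (x : R) : R := vpi M th sT1 t x + c t * x.
Definition Hp t (y : R) : R := C t y + alpha * E t (fun d => Vp t.+1 (y - d)).

Lemma integ_Vp t (y : R) : (t < T)%N -> integ M t (fun d => Vp t.+1 (y - d)).
Proof.
by move=> tT; apply: integD; [exact: (gm_vpi ok)|exact: (integ_affine ok)].
Qed.

Lemma Vp_T (x : R) : Vp T x = 0.
Proof. by rewrite /Vp /vpi subnn /= mulNr addNr. Qed.

Lemma Vp_step t (x : R) : (t < T)%N ->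
  Vp t x = K t * delta (ypol M th sT1 t x - x) + Hp t (ypol M th sT1 t x).
Proof.
move=> tT; rewrite /Vp {1}/vpi.
have -> : (T - t = (T - t.+1).+1)%N by lia.
rewrite /=; have -> : (T - (T - t.+1).+1 = t)%N by lia.
set y := ypol _ _ _ _ _.
have := cost_shift ok x tT (gm_vpi ok tT y); rewrite -/(Hp t y) /vpi => h.
transitivity (K t * delta (y - x) + (- (c t * x) + Hp t y) + c t * x); last ring.
by rewrite -h; ring.
Qed.

(** The policy and the grid model take the same action, so the setup costs cancel and only the
    continuation costs differ. *)
Lemma Vp_sub t (x : R) : (t < T)%N ->
  Vp t x - V t x = Hp t (ypol M th sT1 t x) - H t (ypol M th sT1 t x).
Proof.
move=> tT; have sS := sp_sS (stage_specP ok tT).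
rewrite Vp_step// /ypol; case: (ltP x (s t)) => [xs|sx].
  rewrite V_ltE// /delta subr_gt0 (lt_le_trans xs sS); ring.
by rewrite V_geE// subrr /delta ltxx; ring.
Qed.

Lemma Vp_last (x : R) : Vp T.-1 x = V T.-1 x.
Proof.
apply/eqP; rewrite -subr_eq0 Vp_sub ?(last_lt ok)//.
have -> : H T.-1 = C T.-1 by rewrite /Hf gst_last.
rewrite /Hp; have -> : T.-1.+1 = T by have := gm_T ok; lia.
have -> (y : R) : (fun d => Vp T (y - d)) = (fun=> 0) by apply/funext => d; rewrite Vp_T.
by rewrite expect_cst mulr0 addr0 subrr.
Qed.

Lemma Hp_sub_le t (y : R) (h : R -> R) : (t.+1 < T)%N -> integ M t h ->
  (forall d : R, 0 <= d -> `|Vp t.+1 (y - d) - V t.+1 (y - rd d)| <= h d) ->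
  `|Hp t y - H t y| <= alpha * E t h.
Proof.
move=> tT ih hP; have t0T := step_lt tT.
rewrite /Hp (Hf_step ok)//.
have -> (a b e : R) : a + b - (a + e) = b - e by ring.
have iP := integ_Vp y t0T; have iV := integ_V ok t.+1 y t0T.
rewrite ler_norml; apply/andP; split.
  rewrite lerNl opprB; apply: (alphaE_diff_le ok) => // d d0.
  by apply: le_trans (hP d d0); rewrite distrC ler_norm.
by apply: (alphaE_diff_le ok) => // d d0; apply: le_trans (hP d d0); exact: ler_norm.
Qed.

Lemma lam_shift t (z : R) i :
  lam M th sT1 t z i.+1 = lam M th sT1 t.+1 (Num.max z (S t) + th) i.
Proof.
elim: i => [|i IH]; first by rewrite /= addn0.
by rewrite [LHS]/= -/(lam M th sT1 t z i.+1) IH /= addSnnS.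
Qed.

Lemma epsbar_last (z : R) : epsb (T - 2) z = alpha * gamma T.-1 * th.
Proof.
rewrite /epsbar; have -> : (T.-1 - (T - 2) = 1)%N by have := gm_T ok; lia.
by rewrite subnn big_geq// addr0 expr1.
Qed.

Lemma epsbar_step t (z : R) : (t.+1 < T.-1)%N ->
  epsb t z = alpha * epsb t.+1 (Num.max z (S t) + th)
    + 2 * (p true t (Num.max z (S t)) - gamma t * th).
Proof.
move=> tT; rewrite /epsbar.
have -> : (T - 2 - t = (T - 2 - t.+1).+1)%N by lia.
have -> : (T.-1 - t = (T.-1 - t.+1).+1)%N by lia.
rewrite big_nat_recl//= addn0 expr0 mulr1 exprS.
have -> : \sum_(0 <= i < T - 2 - t.+1) 2 * alpha ^+ i.+1 *
      (psib M th sT1 gamma (t + i.+1) th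
         (Num.max (lam M th sT1 t z i.+1) (Sg M th sT1 (t + i.+1))) - gamma (t + i.+1) * th) =
    alpha * \sum_(0 <= i < T - 2 - t.+1) 2 * alpha ^+ i *
      (psib M th sT1 gamma (t.+1 + i) th
         (Num.max (lam M th sT1 t.+1 (Num.max z (Sg M th sT1 t) + th) i)
            (Sg M th sT1 (t.+1 + i))) - gamma (t.+1 + i) * th).
  by rewrite mulr_sumr; apply: eq_bigr => i _; rewrite lam_shift -addSnnS exprS; ring.
have -> : p true t (Num.max z (S t)) = psib M th sT1 gamma t th (Num.max z (S t)) by [].
ring.
Qed.

Lemma grid_max (x y : R) : grid x -> grid y -> grid (Num.max x y).
Proof. by move=> gx gy; rewrite /Num.max; case: ifP. Qed.

Lemma grid_S t : (t.+1 < T)%N -> grid (S t).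
Proof. by move=> tT; have [] := Sg_spec ok tT. Qed.

Lemma predT_gt0 : (0 < T.-1)%N.
Proof. by have := gm_T ok; lia. Qed.

Lemma epsbar_mono t : (t < T.-1)%N ->
  forall z z' : R, grid z -> grid z' -> z <= z' -> epsb t z <= epsb t z'.
Proof.
move: t; apply: downward_ind => [|z z' _ _ _|t tT IH z z' gz gz' zz']; first exact: predT_gt0.
  by rewrite -subn2 !epsbar_last.
have t1T : (t.+1 < T)%N by lia.
have gS := grid_S t1T.
have mm : Num.max z (S t) <= Num.max z' (S t) by rewrite ge_max !le_max zz' lexx orbT.
rewrite (epsbar_step z tT) (epsbar_step z' tT).
have gm1 := grid_max gz gS; have gm2 := grid_max gz' gS.
have h1 := Psi_mono ok true t1T gm1 gm2 mm.
have h2 : alpha * epsb t.+1 (Num.max z (S t) + th) <= alpha * epsb t.+1 (Num.max z' (S t) + th).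
  by rewrite ler_wpM2l ?(alpha_ge0 ok)//; apply: IH; rewrite ?lerD2r//; exact: gridDth.
lra.
Qed.

Lemma policy_error t : (t < T.-1)%N -> forall z x : R, grid z -> z - th < x <= z ->
  `|Vp t x - V t x| <= epsb t z.
Proof.
have th0' := th0; have lT := last_lt ok; have T3 := gm_T ok.
move: t; apply: downward_ind => [|z x gz _|t tT IH z x gz /andP[zx xz]];
  first exact: predT_gt0.
- have e : T.-2.+1 = T.-1 by lia.
  have tT : (T.-2.+1 < T)%N by lia.
  have -> : epsb T.-2 z = alpha * E T.-2 (fun=> gamma T.-1 * th).
    by rewrite -subn2 epsbar_last expect_cst mulrA.
  rewrite Vp_sub ?(step_lt tT)//; set y := ypol _ _ _ _ _.
  apply: Hp_sub_le => //; first exact: integ_cst.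
  move=> d d0; rewrite e Vp_last; have [d1 d2 d3] := rdP th0 d0.
  have h1 : y - d <= y - rd d by lra.
  have h2 : (y - rd d) - (y - d) <= 1%:R * th by lra.
  apply: le_trans (V_last_lip ok h1 (lexx _) h2) _.
  rewrite mul1r Phi_last; case: ifP => // _.
  by rewrite mulr_ge0 ?(gamma_ge0 ok)// ltW.
have t1T : (t.+1 < T)%N by lia.
have t0T := step_lt t1T; have gS := grid_S t1T.
set Z := Num.max z (S t); have gZ : grid Z by exact: grid_max.
have zZ : z <= Z by rewrite le_max lexx.
have SZ : S t <= Z by rewrite le_max lexx orbT.
rewrite Vp_sub//; set y := ypol _ _ _ _ _.
have [gy y1 y2] : [/\ grid (gceil th y), gceil th y - th < y & y <= gceil th y].
  exact: (gceil_cell ok).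
have yZ : gceil th y <= Z.
  apply: (gceil_le th0 gZ); rewrite /y /ypol; case: ifP => _ //; exact: le_trans xz zZ.
have iF := integ_Phi ok true th Z t0T t1T.
have iB : integ M t (fun d => epsb t.+1 (Z + th) + 2 * f true t.+1 (Z - rd d)).
  by apply: integD; [exact: integ_cst|exact: integZ].
have -> : epsb t z = alpha * E t (fun d => epsb t.+1 (Z + th) + 2 * f true t.+1 (Z - rd d)).
  rewrite expectD; [|exact: integ_cst|exact: integZ].
  by rewrite expect_cst expectZ// (epsbar_step z tT) -/Z (Psi_step ok)//; ring.
apply: Hp_sub_le => // d d0; have [d1 d2 d3] := rdP th0 d0.
have [gc c1 c2] : [/\ grid (gceil th (y - d)), gceil th (y - d) - th < y - d &
  y - d <= gceil th (y - d)] by exact: (gceil_cell ok).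
have h1 : `|Vp t.+1 (y - d) - V t.+1 (y - d)| <= epsb t.+1 (Z + th).
  apply: le_trans (IH _ _ gc _) _; first by rewrite c1.
  by apply: epsbar_mono; [by []|by []|exact: gridDth|apply: (gceil_le th0); [exact: gridDth|lra]].
have gr := rd_grid th d; have gyr := gridB gy gr; have gZr := gridB gZ gr.
(* y need not be a grid point, so y - rd d lies somewhere in its cell and y - d up to one cell
   further left. Two cells are covered, whence the factor 2 in epsbar. *)
have h2 : `|V t.+1 (y - d) - V t.+1 (y - rd d)| <=
    1%:R * f false t.+1 (gceil th y - rd d) + f true t.+1 (gceil th y - rd d).
  by apply: (V_modulus ok) => //; lra.
have h3 := Phi_falseW ok t1T gyr.
have h4 : f true t.+1 (gceil th y - rd d) <= f true t.+1 (Z - rd d).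
  by apply: (Phi_mono ok) => //; lra.
have := ler_distD (V t.+1 (y - d)) (Vp t.+1 (y - d)) (V t.+1 (y - rd d)).
by rewrite mul1r in h2; lra.
Qed.

Lemma total_error (z x : R) : grid z -> z - th < x <= z ->
  `|vpi M th sT1 0 x - vopt M 0 x| <= omegabar M th sT1 gamma 0 z + epsb 0 z.
Proof.
move=> gz zx; have T0 : (0 < T)%N by have := gm_T ok; lia.
have := policy_error predT_gt0 gz zx; have := optimal_error ok T0 gz zx.
have -> : vpi M th sT1 0 x - vopt M 0 x = Vp 0 x - Vs M 0 x by rewrite /Vp /Vs; ring.
have := ler_distD (V 0 x) (Vp 0 x) (Vs M 0 x); lra.
Qed.

End PolicyValue.

(** * Bounds by products of distribution functions *)

Section SimpleBounds.
Variables (R : realType) (M : invModel R) (sT1 : R) (gamma : nat -> R) (th : R).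
Hypothesis ok : grid_model M sT1 gamma th.
Local Notation T := (horizon M).
Local Notation alpha := (disc M).
Local Notation m := (Cmin M).
Local Notation SU := (SU M th).
Local Notation S := (Sg M th sT1).
Local Notation s := (sg M th sT1).
Local Notation grid := (onGrid th).
Local Notation E := (expect M).
Local Notation rd := (rd th).

Let th0 := gm_th ok.

Local Notation p b t := (Psi M sT1 gamma th b t th).
Local Notation f b t := (Phi M sT1 gamma th b t th).

Local Notation F := (Defs.cdf M).
Local Notation omb := (omegabar M th sT1 gamma).
Local Notation epsb := (epsbar M th sT1 gamma).

(** Each factor bounds the chance that one more demand leaves the stock at or above the next s. The
    shift by one cell per stage allows for rounding. *)
Definition fill_prob t n (z : R) : R :=
  \prod_(0 <= m < n) F (t + m) (z + m.+1%:R * th - s (t + m).+1).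

Definition gamma_tail t (z : R) : R :=
  \sum_(1 <= n < T - t) alpha ^+ n * gamma (t + n) * fill_prob t n z.

Lemma fill_probS t n (z : R) : fill_prob t n.+1 z = F t (z + th - s t.+1) * fill_prob t.+1 n (z + th).
Proof.
rewrite /fill_prob big_nat_recl//= addn0 mul1r; congr (_ * _); apply: eq_bigr => i _.
by rewrite addSnnS; congr (F _ (_ - _)); rewrite -[in LHS]natr1; ring.
Qed.

Lemma fill_prob0 t (z : R) : fill_prob t 0 z = 1.
Proof. by rewrite /fill_prob big_geq. Qed.

Lemma gamma_tail_last (z : R) : gamma_tail T.-1 z = 0.
Proof. by rewrite /gamma_tail big_geq//; have := gm_T ok; lia. Qed.

Lemma gamma_tail_step t (z : R) : (t.+1 < T)%N ->
  gamma_tail t z = alpha * F t (z + th - s t.+1) * (gamma t.+1 + gamma_tail t.+1 (z + th)).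
Proof.
move=> tT; rewrite /gamma_tail; have -> : (T - t = (T - t.+1).+1)%N by lia.
rewrite big_add1/=; have -> : (T - t.+1 = (T - t.+1).-1.+1)%N by lia.
rewrite big_nat_recl// big_add1/= expr1 fill_probS fill_prob0 addn1 mulr1 mulrDr mulr_sumr.
congr (_ + _); first by ring.
apply: eq_bigr => n _; rewrite [fill_prob t _ _]fill_probS exprS addnS addSn; ring.
Qed.

Lemma fill_prob_le1 t n (z : R) : fill_prob t n z <= 1.
Proof. by apply: prodr_ile1 => i _; rewrite cdf_ge0 cdf_le1. Qed.

Lemma Phi_le_Psi_mono b t (z z' : R) : (t < T)%N -> grid z -> grid z' -> z <= z' ->
  f b t z <= p b t z'.
Proof.
move=> /ltn_last_or[->|tT] gz gz' zz'.
  rewrite Phi_last Psi_last; case: ifP => // _.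
  by rewrite mulr_ge0 ?(gamma_ge0 ok) ?(last_lt ok)// ltW.
exact: le_trans (Phi_le_Psi ok b tT gz) (Psi_mono ok b tT gz gz' zz').
Qed.

Lemma Psi_nonneg b t (z : R) : (t < T)%N -> grid z -> 0 <= p b t z.
Proof.
move=> tT gz; apply: le_trans (Phi_ge0 ok b tT gz) _.
exact: Phi_le_Psi_mono.
Qed.

(** phi_{t+1} at z - rd d is nonzero only if d <= z + th - s_{t+1}, and it is then at most psi_{t+1}
    at z + th, because rd d >= -th. So the expectation is at most that value times one distribution
    function, and the bound iterates. *)
Lemma Psi_le_tail t : (t < T)%N -> forall (b : bool) (z : R), grid z ->
  p b t z - gamma t * th <= th * gamma_tail t z.
Proof.
have th0' := th0.
move: t; apply: downward_ind => [|b z _|t tT IH b z gz].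
- by have := gm_T ok; lia.
- by rewrite Psi_last gamma_tail_last mulr0 subrr.
have t0T := step_lt tT; have gz1 := gridDth gz.
rewrite (Psi_step ok)// gamma_tail_step//.
set q := z + th - s t.+1; set p' := p b t.+1 (z + th).
have p0 : 0 <= p' by exact: Psi_nonneg.
have ii : integ M t (fun d => \1_`]-oo, q] d) by exact: integrable_indic.
have h : E t (fun d => f b t.+1 (z - rd d)) <= p' * F t q.
  rewrite -cdf_indic -expectZ//; apply: (expect_le (gm_P0 ok t0T)).
  - exact: (integ_Phi ok).
  - exact: integZ.
  move=> d d0; have [d1 d2 d3] := rdP th0 d0; have gd := gridB gz (rd_grid th d).
  have [zs|sz] := ltP (z - rd d) (s t.+1).
    by rewrite Phi_lt// mulr_ge0// indicE ler0n.
  rewrite indicE mem_set ?mulr1; first by apply: Phi_le_Psi_mono => //; lra.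
  by rewrite /= in_itv/= /q; lra.
have h2 := IH b _ gz1; rewrite -/p' in h2.
have a0 := alpha_ge0 ok; have F0 := cdf_ge0 M t q.
have h3 : p' * F t q <= (gamma t.+1 * th + th * gamma_tail t.+1 (z + th)) * F t q.
  by apply: ler_wpM2r => //; lra.
have := ler_wpM2l a0 (le_trans h h3).
have -> : gamma t * th + alpha * E t (fun d => f b t.+1 (z - rd d)) - gamma t * th =
  alpha * E t (fun d => f b t.+1 (z - rd d)) by ring.
by move=> /le_trans; apply; rewrite le_eqVlt; apply/orP; left; apply/eqP; ring.
Qed.

Lemma lam_grid t (z : R) i : grid z -> (t + i < T)%N -> grid (lam M th sT1 t z i).
Proof.
move=> gz; elim: i => [//|i IH] iT /=; apply: gridDth; apply: grid_max.
  by apply: IH; lia.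
by apply: (grid_S ok); lia.
Qed.

Lemma epsbar_le_Ueps0 (z : R) : grid z -> epsb 0 z <= Ueps0 M th sT1 gamma z.
Proof.
move=> gz; rewrite /epsbar /Ueps0 !subn0 mulr_sumr; have T3 := gm_T ok.
rewrite lerD2l; apply: ler_sum_nat => i /andP[_ iT]; rewrite add0n.
have -> : \sum_(1 <= n < T - i) alpha ^+ (n + i) * gamma (i + n) *
     \prod_(0 <= m0 < n) F (i + m0) (Num.max (lam M th sT1 0 z i) (S i) + m0.+1%:R * th - s (i + m0).+1)
   = alpha ^+ i * gamma_tail i (Num.max (lam M th sT1 0 z i) (S i)).
  by rewrite /gamma_tail mulr_sumr; apply: eq_bigr => n _; rewrite exprD /fill_prob; ring.
have iT' : (i.+1 < T)%N by lia.
have gm' : grid (Num.max (lam M th sT1 0 z i) (S i)).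
  by apply: grid_max; [apply: lam_grid => //; lia|exact: (grid_S ok)].
have := @Psi_le_tail i (step_lt iT') true _ gm'.
rewrite -/(Psi M sT1 gamma th true i) => h.
have a0 : 0 <= 2 * alpha ^+ i by rewrite mulr_ge0// exprn_ge0// (alpha_ge0 ok).
have -> : psib M th sT1 gamma i = Psi M sT1 gamma th true i by [].
by have := ler_wpM2l a0 h; lra.
Qed.

Lemma mu0_grid (z : R) i : grid z -> (i < T)%N -> grid (mu0 M th z i).
Proof.
move=> gz; elim: i => [//|i IH] iT /=; apply: gridDth; apply: grid_max.
  by apply: IH; lia.
by have [] := SU_spec ok (step_lt iT).
Qed.

(** Both branches of omegabar are at most bar psi at S^U_t plus omega_t at the larger of z and
    S^U_t. The inherited error is then taken one cell higher, which generates the recursion of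
    [mu0]. *)
Lemma omegabar_step_le t (z : R) : (t.+1 < T)%N -> grid z ->
  omb t z <= gamma t * th + th * (gamma_tail t (SU t) + gamma_tail t (Num.max z (SU t)))
    + alpha * omb t.+1 (Num.max z (SU t) + th).
Proof.
move=> tT gz; have t0T := step_lt tT; have [gS _ _] := SU_spec ok t0T.
have gm' : grid (Num.max z (SU t)) by exact: grid_max.
have pS := Psi_ge0 ok true tT gS.
have h1 : omb t z <= p true t (SU t) + om M sT1 gamma th t (Num.max z (SU t)).
  rewrite (omegabar_step ok)// /eta; have [zS|Sz] := leP z (SU t); first by [].
  by rewrite ge_max lerDr pS andbT lerD2l (om_mono ok)// ltW.
apply: le_trans h1 _.
have h2 := Psi_le_tail t0T true gS; have h3 := Psi_le_tail t0T false gm'.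
have h4 : E t (fun d => omb t.+1 (Num.max z (SU t) - rd d)) <= omb t.+1 (Num.max z (SU t) + th).
  apply: (expect_le_cst (gm_P0 ok t0T)); first exact: (integ_omegabar ok).
  move=> d d0; have [d1 d2 d3] := rdP th0 d0; apply: (omegabar_mono ok) => //.
  - exact: gridB (rd_grid th d).
  - exact: gridDth.
  - by rewrite lerD2l; lra.
have := ler_wpM2l (alpha_ge0 ok) h4.
by rewrite /om; lra.
Qed.

Lemma omegabar_partial_sum (z : R) j : grid z -> (j < T)%N ->
  omb 0 z <= th * \sum_(0 <= i < j) alpha ^+ i *
      (gamma i + (gamma_tail i (SU i) + gamma_tail i (Num.max (mu0 M th z i) (SU i))))
    + alpha ^+ j * omb j (mu0 M th z j).
Proof.
move=> gz; elim: j => [|j IH] jT.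
  by rewrite big_geq// mulr0 add0r expr0 mul1r.
apply: le_trans (IH (step_lt jT)) _.
rewrite big_nat_recr//= mulrDr -addrA lerD2l.
have a0 : 0 <= alpha ^+ j by rewrite exprn_ge0// (alpha_ge0 ok).
have := ler_wpM2l a0 (omegabar_step_le jT (mu0_grid gz (step_lt jT))).
by rewrite exprSr; lra.
Qed.

Lemma omegabar_le_Uomega0 (z : R) : grid z -> omb 0 z <= Uomega0 M th sT1 gamma z.
Proof.
move=> gz; apply: le_trans (omegabar_partial_sum gz (last_lt ok)) _.
rewrite omegabar_last mulr0 addr0 /Uomega0 -mulrDr -big_split/=.
rewrite le_eqVlt; apply/orP; left; apply/eqP; congr (_ * _).
apply: eq_bigr => i _; rewrite mulrDr; congr (_ + _).
rewrite /gamma_tail -big_split/= mulr_sumr; apply: eq_bigr => n _.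
by rewrite exprD /fill_prob; ring.
Qed.

Lemma gamma_weight_ge0 i n : (n < T - i)%N -> 0 <= alpha ^+ (n + i) * gamma (i + n).
Proof.
move=> nT; rewrite mulr_ge0 ?exprn_ge0 ?(alpha_ge0 ok)// (gamma_ge0 ok)//; lia.
Qed.

Lemma Uomega0_le (z : R) : Uomega0 M th sT1 gamma z <= Uomegabar0 M th gamma.
Proof.
rewrite /Uomega0 /Uomegabar0 lerD2l (mulrC 2) -mulrA ler_wpM2l ?(ltW th0)//.
rewrite mulr_sumr; apply: ler_sum_nat => i iT.
rewrite mulr_sumr; apply: ler_sum_nat => n /andP[_ nT].
rewrite mulrC; apply: ler_wpM2r; first exact: gamma_weight_ge0.
have := fill_prob_le1 i n (SU i); have := fill_prob_le1 i n (Num.max (mu0 M th z i) (SU i)).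
by rewrite /fill_prob; lra.
Qed.

Lemma Ueps0_le (z : R) : Ueps0 M th sT1 gamma z <= Uepsbar0 M th gamma.
Proof.
rewrite /Ueps0 /Uepsbar0 lerD2l ler_wpM2l ?mulr_ge0 ?(ltW th0)//.
apply: ler_sum_nat => i iT; apply: ler_sum_nat => n /andP[_ nT].
rewrite -[leRHS]mulr1 ler_wpM2l ?gamma_weight_ge0//.
exact: (fill_prob_le1 i n (Num.max (lam M th sT1 0 z i) (S i))).
Qed.

End SimpleBounds.

Unset Implicit Arguments.
Set Strict Implicit.
Set Printing Implicit Defensive.

Theorem theorem4p6 (R : realType) (M : invModel R) (sT1 : R) (gamma : nat -> R) :
  (* T >= 3, alpha in (0,1] *)
  (3 <= horizon M)%N ->
  0 < disc M <= 1 ->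
  (* K_t >= 0 and K_t >= alpha K_{t+1} *)
  (forall t, (t < horizon M)%N -> 0 <= setup M t) ->
  (forall t, (t.+1 < horizon M)%N -> disc M * setup M t.+1 <= setup M t) ->
  (* nonnegative demands with finite means *)
  (forall t, (t < horizon M)%N -> demand M t `]-oo, 0[ = 0%E) ->
  (forall t, (t < horizon M)%N -> (demand M t).-integrable setT (fun d => d%:E)) ->
  (* C_t convex and C_t(y) -> +oo as |y| -> oo *)
  (forall t, (t < horizon M)%N -> forall x y l, 0 <= l <= 1 ->
     Cfun M t (l * x + (1 - l) * y) <= l * Cfun M t x + (1 - l) * Cfun M t y) ->
  (forall t, (t < horizon M)%N -> forall A : R, exists B : R,
     forall y, B <= `|y| -> A <= Cfun M t y) ->
  (* the point s_{T-1} *)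
  sT1 <= Cmin M (horizon M).-1 ->
  Cfun M (horizon M).-1 sT1
    = Cfun M (horizon M).-1 (Cmin M (horizon M).-1) + setup M (horizon M).-1 ->
  (* all expectations appearing are finite *)
  (forall t, (t < horizon M)%N -> forall y,
     (demand M t).-integrable setT (fun d => (vopt M t.+1 (y - d))%:E)) ->
  (forall th, 0 < th -> forall t, (t < horizon M)%N -> forall y,
     (demand M t).-integrable setT (fun d => (vpi M th sT1 t.+1 (y - d))%:E)) ->
  (forall th, 0 < th -> forall t, (t.+1 < horizon M)%N -> forall y,
     cvgn (fun N => \sum_(k < N)
       Vfun M th sT1 t.+1 (y - zg th (k%:Z - 1)) * fmass M th t (k%:Z - 1))) ->
  (forall th, 0 < th -> forall t, (t.+1 < horizon M)%N -> forall y,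
     cvgn (fun N => \sum_(k < N)
       omegabar M th sT1 gamma t.+1 (y - zg th (k%:Z - 1)) * fmass M th t (k%:Z - 1))) ->
  (* Lipschitz constants gamma_t *)
  (forall t, (t < horizon M)%N ->
     0 <= gamma t /\ forall x y, `|Cfun M t x - Cfun M t y| <= gamma t * `|x - y|) ->
  (forall th, 0 < th -> forall (k : int) (x : R),
     zg th (k - 1) < x <= zg th k ->
     `|vpi M th sT1 0 x - vopt M 0 x|
        <= omegabar M th sT1 gamma 0 (zg th k) + epsbar M th sT1 gamma 0 (zg th k)
     /\ omegabar M th sT1 gamma 0 (zg th k) + epsbar M th sT1 gamma 0 (zg th k)
        <= Uomega0 M th sT1 gamma (zg th k) + Ueps0 M th sT1 gamma (zg th k)
     /\ Uomega0 M th sT1 gamma (zg th k) + Ueps0 M th sT1 gamma (zg th k)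
        <= Uomegabar0 M th gamma + Uepsbar0 M th gamma)
  /\ (fun th => sup [set `|vpi M th sT1 0 x - vopt M 0 x| | x in [set: R]])
       @ 0^'+ --> 0.
Proof.
move=> T3 al K0 Ka P0 mean conv coer sT1m sT1E ivopt ivpi _ _ lip.
have ok (th : R) : 0 < th -> grid_model M sT1 gamma th.
  by move=> th0; split=> //; exact: ivpi.
have bound (th : R) : 0 < th -> forall (k : int) (x : R), zg th (k - 1) < x <= zg th k ->
  `|vpi M th sT1 0 x - vopt M 0 x|
     <= omegabar M th sT1 gamma 0 (zg th k) + epsbar M th sT1 gamma 0 (zg th k)
  /\ omegabar M th sT1 gamma 0 (zg th k) + epsbar M th sT1 gamma 0 (zg th k)
     <= Uomega0 M th sT1 gamma (zg th k) + Ueps0 M th sT1 gamma (zg th k)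
  /\ Uomega0 M th sT1 gamma (zg th k) + Ueps0 M th sT1 gamma (zg th k)
     <= Uomegabar0 M th gamma + Uepsbar0 M th gamma.
  move=> /ok okth k x; have gk := grid_zg th k; rewrite zgB zg1 => kx; split.
    exact (total_error okth gk kx).
  by split; apply: lerD;
    [exact (omegabar_le_Uomega0 okth gk)|exact (epsbar_le_Ueps0 okth gk)|exact (Uomega0_le okth _)|exact (Ueps0_le okth _)].
split=> [//|].
(* The coarsest bound equals A th with A independent of x and th, so the error vanishes uniformly in
   x. *)
pose A := (\sum_(0 <= i < (horizon M).-1) disc M ^+ i * gamma i
  + 2 * \sum_(0 <= i < (horizon M).-1) \sum_(1 <= n < horizon M - i)
      disc M ^+ (n + i) * gamma (i + n))
  + (disc M ^+ (horizon M).-1 * gamma (horizon M).-1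
  + 2 * \sum_(0 <= i < horizon M - 2) \sum_(1 <= n < horizon M - i)
      disc M ^+ (n + i) * gamma (i + n)).
have le_A (th x : R) : 0 < th -> `|vpi M th sT1 0 x - vopt M 0 x| <= A * th.
  move=> th0; have /(bound th th0)[h1 [h2 h3]] :
      zg th (Num.ceil (x / th) - 1) < x <= zg th (Num.ceil (x / th)).
    rewrite zgB zg1 (le_gceil th0) andbT.
    by have := gceil_lt th0 x; rewrite /gceil; lra.
  apply: le_trans h1 (le_trans h2 (le_trans h3 _)).
  by rewrite /Uomegabar0 /Uepsbar0 /A le_eqVlt; apply/orP; left; apply/eqP; ring.
have cvA : (fun th : R => A * th) @ 0^'+ --> (0 : R).
  rewrite -[X in _ --> X](mulr0 A); apply: cvgMr.
  exact: cvg_at_right_filter (@cvg_id _ _).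
apply: (squeeze_cvgr _ (@cvg_cst _ 0 _ _ _) cvA).
near=> th; have th0 : 0 < th by near: th; exact: nbhs_right_gt.
(* Boundedness makes this [sup] a genuine supremum, so it dominates the error at 0 and is
   nonnegative. *)
have ub : ubound [set `|vpi M th sT1 0 x - vopt M 0 x| | x in [set: R]] (A * th).
  by move=> _ [x _ <-]; exact: le_A.
apply/andP; split.
  apply: le_trans (normr_ge0 (vpi M th sT1 0 0 - vopt M 0 0)) _.
  by apply: ub_le_sup; [exists (A * th)|exists 0].
by apply: ge_sup => //; exists `|vpi M th sT1 0 0 - vopt M 0 0|, 0.
Unshelve. all: by end_near.
Qed.
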